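(* Let $h_{\nu}(z)=2^{\nu}\Gamma(\nu+1)z^{1-\frac{\nu}{2}}J_{\nu}(\sqrt{z})$, where $\nu>-1$. The function $h_{\nu}$ is convex of order $\alpha\in[0,1)$ in the open unit disk $\mathbb{D}$ if and only if $\nu\geq\nu_{\alpha}(h_\nu)$, where $\nu_{\alpha}(h_\nu)$ is the unique root of the equation $$(2\nu+2\alpha-4)J_{\nu+1}(1)=(4\alpha-3)J_{\nu}(1)$$ situated in $[0,\infty)$. In particular, $h_{\nu}$ is convex if and only if $\nu\geq\nu_0(h_\nu)$, where $\nu_0(h_\nu)\simeq-0.1438\dots$ is the unique root of the equation $$(2\nu-4)J_{\nu+1}(1)+3J_{\nu}(1)=0.$$ Moreover, in particular, the function $h_{\nu}$ is convex of order $\frac{3}{4}$ if and only if $\nu\geq\frac{5}{4}$.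
   Context: $J_\nu$ is the Bessel function of the first kind, $J_{\nu}(z)=\sum_{n\geq0}\frac{(-1)^{n}}{n!\,\Gamma(n+\nu+1)}\left(\frac{z}{2}\right)^{2n+\nu}$. The function $h_\nu$ has the expansion $h_{\nu}(z)=z-\frac{1}{4(\nu+1)}z^2+\dots$. $\mathbb{D}=\{z\in\mathbb{C}:|z|<1\}$. A function $f$ with $f(0)=f'(0)-1=0$ is convex of order $\alpha\in[0,1)$ in $\mathbb{D}$ if it is analytic and univalent in $\mathbb{D}$ and $\operatorname{Re}\left(1+\frac{zf''(z)}{f'(z)}\right)>\alpha$ for all $z\in\mathbb{D}$; convex means convex of order $0$. The notation $\nu_\alpha(h_\nu)$ denotes a number depending only on $\alpha$ (and on the family $h_\nu$), not on the individual value of $\nu$.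
   Formalization: The root ν_α is taken as the unique root in (-1,∞) instead of [0,∞): for α=0 the equation has no root in [0,∞), since ν_0≈-0.1438 is negative, so the interval as stated is inconsistent. *)

(* Defs.v *)
From Stdlib Require Import Reals Factorial.
From Coquelicot Require Import Coquelicot.
Open Scope R_scope.

(** Euler's integral; it converges for [0 < x], the only case used below. *)
Definition Gamma (x : R) : R :=
  RInt_gen (fun t : R => Rpower t (x - 1) * exp (- t))
    (at_right 0) (Rbar_locally p_infty).

Definition Cexp (z : C) : C :=
  (exp (Re z) * cos (Im z), exp (Re z) * sin (Im z)).

(** Principal argument, with values in (-PI, PI] for [z <> 0]. *)
Definition Carg (z : C) : R :=
  if Rle_dec 0 (Im z) then acos (Re z / Cmod z) else - acos (Re z / Cmod z).

Definition Clog (z : C) : C := (ln (Cmod z), Carg z).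

(** Principal power, with the conventions [0 ^ 0 = 1] and [0 ^ a = 0] for
    [a <> 0]. *)
Definition Cpower (z : C) (a : R) : C :=
  if Ceq_dec z 0 then (if Req_EM_T a 0 then RtoC 1 else RtoC 0)
  else Cexp (RtoC a * Clog z)%C.

Definition Csqrt (z : C) : C := Cpower z (1 / 2).

(** Sum of a complex series, taken componentwise. *)
Definition Cseries (a : nat -> C) : C :=
  (Series (fun n => Re (a n)), Series (fun n => Im (a n))).

Definition besselJ (nu : R) (z : C) : C :=
  Cseries (fun n : nat =>
    RtoC ((-1) ^ n / (INR (fact n) * Gamma (INR n + nu + 1)))
    * Cpower (z / RtoC 2) (2 * INR n + nu))%C.

(** All powers being principal, the factors [z ^ (- nu / 2)] and
    [Csqrt z ^ nu] cancel for every [z <> 0], negative reals included.  At the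
    removable singularity 0 the conventions of [Cpower] give the value 0 for
    every [nu], [nu = 2] included because [besselJ 2 0 = 0]. *)
Definition bessel_h (nu : R) (z : C) : C :=
  (RtoC (Rpower 2 nu * Gamma (nu + 1)) * Cpower z (1 - nu / 2)
   * besselJ nu (Csqrt z))%C.

Definition unit_disk (z : C) : Prop := Cmod z < 1.

Definition analytic_on (D : C -> Prop) (f : C -> C) : Prop :=
  forall z : C, D z -> @ex_derive C_AbsRing C_NormedModule f z.

Definition univalent_on (D : C -> Prop) (f : C -> C) : Prop :=
  analytic_on D f /\ forall z w : C, D z -> D w -> f z = f w -> z = w.

(** The quotient is genuine: univalence forces [C_derive f z <> 0] on the
    disk. *)
Definition convex_of_order (alpha : R) (f : C -> C) : Prop :=
  f (RtoC 0) = RtoC 0 /\ C_derive f (RtoC 0) = RtoC 1 /\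
  univalent_on unit_disk f /\
  forall z : C, unit_disk z ->
    Re (RtoC 1 + z * C_derive (C_derive f) z / C_derive f z)%C > alpha.

Definition convex (f : C -> C) : Prop := convex_of_order 0 f.

(* Main.v *)
(** With [a = nu + 1], [bessel_h nu z = z * phi z], where [phi] is the entire
    function with coefficients [(-1)^n / (4^n n! a (a+1) ... (a+n-1))].  Write
    [g = h'] and [F x = x g'(x) + (1 - alpha) g x].  By Bessel's equation the
    equation of the theorem says [F 1 = 0].

    The series [F 1] alternates, and differences of consecutive terms are
    monotone in [a]; so [F 1] increases strictly with [a], has exactly one root,
    and is nonnegative exactly when [nu >= nu_alpha].  The same pairing shows
    that [F] and [g] decrease strictly on [0,1].

    Sufficiency.  If [F 1 >= 0] then [a > 3/4], which gives [|g - 1| < 1] on the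
    disk and hence univalence.  The series [W = - phi' / phi] satisfies the
    Riccati equation [z W' + a W = 1/4 + z W^2], so its coefficients are
    nonnegative and bounded by powers of [1/(4a)].  Since
    [- z g' / g = z W + (z W + z^2 W') / (1 - z W)], the modulus of [z g' / g] at
    [z] is at most the value of [- r g' / g] at [r = |z|], which is less than
    [1 - alpha] because [F r > F 1 >= 0].  No information on zeros is needed.

    Necessity.  If [F 1 < 0], then [F < 0 < g] somewhere on (0,1), just to the
    left of [1] or of the zero of [g], which violates the order condition. *)

Require Import Defs.
From Stdlib Require Import Reals Factorial Lra Lia Wf_nat.
From Coquelicot Require Import Coquelicot.
Open Scope R_scope.

(** * The Gamma function *)

(** For a nonnegative integrand the integral grows with the interval, so the supremum [l] of the
    integrals is also their limit. Integrability and an upper bound for the value come out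
    together. *)
Lemma is_RInt_gen_bounded_nonneg (f : R -> R) (M : R) :
  (forall t, 0 < t -> continuous f t) ->
  (forall t, 0 < t -> 0 <= f t) ->
  (forall a b, 0 < a < 1 -> 1 < b -> RInt f a b <= M) ->
  exists l, is_RInt_gen f (at_right 0) (Rbar_locally p_infty) l /\
    forall a b, 0 < a < 1 -> 1 < b -> RInt f a b <= l.
Proof.
  intros Hc Hp HM.
  assert (Hex : forall a b, 0 < a -> 0 < b -> ex_RInt f a b).
  { intros a b Ha Hb. apply (@ex_RInt_continuous R_CompleteNormedModule).
    intros z Hz. apply Hc. apply Rlt_le_trans with (Rmin a b); [|apply Hz].
    apply Rmin_glb_lt; assumption. }
  destruct (completeness (fun y => exists a b, 0 < a < 1 /\ 1 < b /\ y = RInt f a b))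
    as [l [Hub Hlub]].
  - exists M. intros y (a & b & Ha & Hb & ->). apply HM; assumption.
  - exists (RInt f (1/2) 2), (1/2), 2. repeat split; lra.
  - assert (Hle : forall a b, 0 < a < 1 -> 1 < b -> RInt f a b <= l).
    { intros a b Ha Hb. apply Hub. exists a, b. auto. }
    exists l; split; [|exact Hle].
    intros P [eps HP].
    destruct (Classical_Prop.classic
      (exists a b, 0 < a < 1 /\ 1 < b /\ l - eps < RInt f a b)) as [(a0 & b0 & Ha0 & Hb0 & H0)|Hn].
    2:{ exfalso. assert (l <= l - eps); [|destruct eps; simpl in *; lra].
        apply Hlub. intros y (a & b & Ha & Hb & ->).
        destruct (Rle_or_lt (RInt f a b) (l - eps)); [assumption|].
        exfalso; apply Hn. exists a, b; auto. }
    (* Every interval containing [[a0, b0]] has its integral between [l - eps] and [l]. *)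
    apply (Filter_prod _ _ _ (fun a => 0 < a < a0) (fun b => b0 < b)).
    + exists (mkposreal a0 (proj1 Ha0)). intros y Hy Hy0.
      change (Rabs (minus y 0) < a0) in Hy. unfold minus, plus, opp in Hy; simpl in Hy.
      apply Rabs_def2 in Hy. lra.
    + exists b0. auto.
    + intros a b Ha Hb. exists (RInt f a b). split.
      * apply (RInt_correct (V:=R_CompleteNormedModule)). apply Hex; lra.
      * apply HP. change (Rabs (RInt f a b + - l) < eps).
        assert (RInt f a b <= l) by (apply Hle; lra).
        assert (RInt f a0 b0 <= RInt f a b).
        { rewrite <- (RInt_Chasles f a a0 b) by (apply Hex; lra).
          rewrite <- (RInt_Chasles f a0 b0 b) by (apply Hex; lra).
          change plus with Rplus.
          assert (0 <= RInt f a a0)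
            by (apply RInt_ge_0; [lra|apply Hex; lra|intros; apply Hp; lra]).
          assert (0 <= RInt f b0 b)
            by (apply RInt_ge_0; [lra|apply Hex; lra|intros; apply Hp; lra]).
          lra. }
        apply Rabs_def1; destruct eps; simpl in *; lra.
Qed.

Definition gamma_integrand (x t : R) : R := Rpower t (x - 1) * exp (- t).

Lemma gamma_integrand_continuous (x t : R) :
  0 < t -> continuous (gamma_integrand x) t.
Proof.
  intros Ht. apply (ex_derive_continuous (K:=R_AbsRing) (V:=R_NormedModule)).
  unfold gamma_integrand, Rpower. auto_derive. assumption.
Qed.

Lemma gamma_integrand_pos (x t : R) : 0 < gamma_integrand x t.
Proof. apply Rmult_lt_0_compat; apply exp_pos. Qed.

(** Half of the exponential absorbs the power of [t]: [ln u <= u - 1] at [u = t / s] gives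
    [ln t <= ln s + t / s], and the choice of [s] makes [Rabs (x - 1) / s] at most [1 / 2]. *)
Lemma gamma_integrand_tail (x : R) :
  exists C, 0 < C /\ forall t, 1 <= t -> gamma_integrand x t <= C * exp (- (t / 2)).
Proof.
  set (s := 2 * (Rabs (x - 1) + 1)).
  assert (Hs : 0 < s) by (unfold s; generalize (Rabs_pos (x - 1)); lra).
  exists (exp (Rabs (x - 1) * ln s)). split; [apply exp_pos|].
  intros t Ht. unfold gamma_integrand, Rpower. rewrite <- !exp_plus.
  assert (H : (x - 1) * ln t + - t <= Rabs (x - 1) * ln s + - (t / 2)).
  { assert (Hl0 : 0 <= ln t).
    { rewrite <- ln_1. destruct Ht as [Ht|<-]; [left; apply ln_increasing; lra|lra]. }
    assert (Hl : ln t <= ln s + t / s).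
    { replace t with (s * (t / s)) at 1 by (field; lra).
      assert (0 < t / s) by (apply Rdiv_lt_0_compat; lra).
      rewrite ln_mult by lra.
      assert (ln (t / s) <= t / s - 1); [|lra].
      generalize (exp_ineq1_le (ln (t / s))). rewrite exp_ln by assumption. lra. }
    assert ((x - 1) * ln t <= Rabs (x - 1) * ln t)
      by (apply Rmult_le_compat_r; [assumption|apply Rle_abs]).
    assert (Rabs (x - 1) * ln t <= Rabs (x - 1) * (ln s + t / s))
      by (apply Rmult_le_compat_l; [apply Rabs_pos|assumption]).
    assert (Rabs (x - 1) * (t / s) <= t / 2); [|lra].
    replace (t / 2) with ((Rabs (x - 1) + 1) * (t / s)) by (unfold s; field; unfold s in Hs; lra).
    apply Rmult_le_compat_r; [|lra]. apply Rlt_le, Rdiv_lt_0_compat; lra. }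
  destruct H as [H|H]; [left; apply exp_increasing; assumption|right; f_equal; assumption].
Qed.

Lemma Gamma_convergent (x : R) : 0 < x ->
  is_RInt_gen (gamma_integrand x) (at_right 0) (Rbar_locally p_infty) (Gamma x) /\
  0 < Gamma x.
Proof.
  intros Hx.
  assert (Hex : forall a b, 0 < a -> 0 < b -> ex_RInt (gamma_integrand x) a b).
  { intros a b Ha Hb. apply (@ex_RInt_continuous R_CompleteNormedModule).
    intros z Hz. apply gamma_integrand_continuous.
    apply Rlt_le_trans with (Rmin a b); [|apply Hz].
    apply Rmin_glb_lt; assumption. }
  destruct (gamma_integrand_tail x) as (C & HC & Htail).
  (* The summand [1 / x] bounds the integral of [t ^ (x - 1)] over (0,1), and [2 * C] that of
     [C * exp (- (t / 2))] over the half-line from 1. *)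
  destruct (is_RInt_gen_bounded_nonneg (gamma_integrand x) (1 / x + 2 * C))
    as (l & Hl & Hle).
  - apply gamma_integrand_continuous.
  - intros; apply Rlt_le, gamma_integrand_pos.
  - intros a b Ha Hb.
    rewrite <- (RInt_Chasles _ a 1 b) by (apply Hex; lra).
    change plus with Rplus. apply Rplus_le_compat.
    + assert (HI : is_RInt (fun t => Rpower t (x - 1)) a 1 (1 / x - Rpower a x / x)).
      { replace (1 / x) with (Rpower 1 x / x)
          by (unfold Rpower; rewrite ln_1, Rmult_0_r, exp_0; reflexivity).
        apply (is_RInt_derive (V:=R_CompleteNormedModule) (fun t => Rpower t x / x)).
        - intros t Ht. rewrite Rmin_left, Rmax_right in Ht by lra.
          unfold Rpower. auto_derive; [lra|].
          replace ((x - 1) * ln t) with (x * ln t + - ln t) by ring.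
          rewrite exp_plus, exp_Ropp, exp_ln by lra. field. lra.
        - intros t Ht. rewrite Rmin_left, Rmax_right in Ht by lra.
          apply (ex_derive_continuous (K:=R_AbsRing) (V:=R_NormedModule)).
          unfold Rpower. auto_derive. lra. }
      apply Rle_trans with (1 / x - Rpower a x / x).
      * rewrite <- (is_RInt_unique _ _ _ _ HI).
        apply RInt_le; [lra|apply Hex; lra|eexists; exact HI|].
        intros t Ht. unfold gamma_integrand.
        rewrite <- (Rmult_1_r (Rpower t (x - 1))) at 2.
        apply Rmult_le_compat_l; [apply Rlt_le, exp_pos|].
        rewrite <- exp_0. left; apply exp_increasing; lra.
      * assert (0 < Rpower a x / x) by (apply Rdiv_lt_0_compat; [apply exp_pos|lra]). lra.
    + assert (HI : is_RInt (fun t => C * exp (- (t / 2))) 1 b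
                     ((-2 * C * exp (- (b / 2))) - (-2 * C * exp (- (1 / 2))))).
      { apply (is_RInt_derive (V:=R_CompleteNormedModule) (fun t => -2 * C * exp (- (t / 2)))).
        - intros t _. auto_derive; [trivial|]. unfold Rdiv; field.
        - intros t _. apply (ex_derive_continuous (K:=R_AbsRing) (V:=R_NormedModule)).
          auto_derive; trivial. }
      apply Rle_trans with ((-2 * C * exp (- (b / 2))) - (-2 * C * exp (- (1 / 2)))).
      * rewrite <- (is_RInt_unique _ _ _ _ HI).
        apply RInt_le; [lra|apply Hex; lra|eexists; exact HI|].
        intros t Ht. apply Htail; lra.
      * assert (0 < C * exp (- (b / 2))) by (apply Rmult_lt_0_compat; [lra|apply exp_pos]).
        assert (exp (- (1 / 2)) < 1)
          by (apply Rlt_le_trans with (exp 0); [apply exp_increasing; lra|rewrite exp_0; lra]).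
        assert (C * exp (- (1 / 2)) < C * 1) by (apply Rmult_lt_compat_l; lra). lra.
  - assert (HG : Gamma x = l).
    { apply (is_RInt_gen_unique (V:=R_CompleteNormedModule) (gamma_integrand x)). exact Hl. }
    rewrite HG. split; [exact Hl|].
    apply Rlt_le_trans with (RInt (gamma_integrand x) (1 / 2) 2); [|apply Hle; lra].
    apply RInt_gt_0; [lra|intros; apply gamma_integrand_pos|].
    intros t Ht. apply gamma_integrand_continuous; lra.
Qed.

Lemma Gamma_pos (x : R) : 0 < x -> 0 < Gamma x.
Proof. intros Hx; apply (Gamma_convergent x Hx). Qed.

(** Integration by parts: [F t = t ^ x * exp (- t)] tends to 0 at both ends, and its derivative is
    [x] times the integrand at [x] minus the integrand at [x + 1]. *)
Lemma Gamma_succ (x : R) : 0 < x -> Gamma (x + 1) = x * Gamma x.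
Proof.
  intros Hx.
  destruct (Gamma_convergent x Hx) as [H1 _].
  destruct (Gamma_convergent (x + 1)) as [H2 _]; [lra|].
  pose (F := fun t => Rpower t x * exp (- t)).
  assert (HF : forall t, 0 < t ->
     is_derive F t (x * gamma_integrand x t - gamma_integrand (x + 1) t)).
  { intros t Ht. unfold F, gamma_integrand, Rpower. auto_derive; [assumption|].
    replace ((x - 1) * ln t) with (x * ln t + - ln t) by ring.
    replace (x + 1 - 1) with x by ring.
    rewrite exp_plus, (exp_Ropp (ln t)), exp_ln by lra. field. lra. }
  assert (Hpos : filter_prod (at_right 0) (Rbar_locally p_infty)
    (fun ab : R * R => 0 < Rmin (fst ab) (snd ab))).
  { apply (Filter_prod _ _ _ (fun a => 0 < a) (fun b => 0 < b)).
    - exists (mkposreal 1 Rlt_0_1). auto.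
    - exists 0. auto.
    - intros; apply Rmin_glb_lt; assumption. }
  assert (Hlim : is_RInt_gen (Derive F) (at_right 0) (Rbar_locally p_infty) (0 - 0)).
  { apply is_RInt_gen_Derive.
    - refine (filter_imp _ _ _ Hpos). intros ab Hab t Ht.
      eexists; apply HF; lra.
    - refine (filter_imp _ _ _ Hpos). intros ab Hab t Ht.
      apply (continuous_ext_loc _ (fun t => x * gamma_integrand x t - gamma_integrand (x + 1) t)).
      + assert (Ht0 : 0 < t) by lra. exists (mkposreal t Ht0). intros y Hy.
        symmetry; apply is_derive_unique, HF.
        change (Rabs (y + - t) < t) in Hy. apply Rabs_def2 in Hy; lra.
      + apply (continuous_minus (V:=R_NormedModule));
          [apply (continuous_scal_r (V:=R_NormedModule) x)|];
        apply gamma_integrand_continuous; lra.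
    - intros P [eps HP].
      exists (mkposreal (Rpower eps (1 / x)) (exp_pos _)). intros t Ht Ht0.
      apply HP. change (Rabs (F t + - 0) < eps).
      change (Rabs (t + - 0) < Rpower eps (1 / x)) in Ht.
      rewrite Rabs_pos_eq in Ht by lra.
      assert (0 < F t) by (apply Rmult_lt_0_compat; apply exp_pos).
      rewrite Rabs_pos_eq by lra.
      assert (Rpower t x < eps).
      { replace (pos eps) with (Rpower (Rpower eps (1 / x)) x).
        - apply Rlt_Rpower_l; lra.
        - rewrite Rpower_mult. replace (1 / x * x) with 1 by (field; lra).
          apply Rpower_1, cond_pos. }
      assert (exp (- t) < 1) by (rewrite <- exp_0; apply exp_increasing; lra).
      assert (0 < Rpower t x) by apply exp_pos. unfold F in *. nra.
    (* The integrand of [Gamma (x + 1)] is [F] itself, so the tail estimate bounds [F]. *)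
    - destruct (gamma_integrand_tail (x + 1)) as (C & HC & HT).
      intros P [eps HP].
      exists (Rmax 1 (2 * (- ln (eps / C)))). intros t Ht.
      assert (1 < t) by (eapply Rle_lt_trans; [apply Rmax_l|apply Ht]).
      assert (2 * - ln (eps / C) < t) by (eapply Rle_lt_trans; [apply Rmax_r|apply Ht]).
      apply HP. change (Rabs (F t + - 0) < eps).
      assert (0 < F t) by (apply Rmult_lt_0_compat; apply exp_pos).
      rewrite Rabs_pos_eq by lra.
      specialize (HT t ltac:(lra)). unfold gamma_integrand in HT.
      replace (x + 1 - 1) with x in HT by ring. fold (F t) in HT.
      assert (exp (- (t / 2)) < eps / C).
      { rewrite <- (exp_ln (eps / C)) by (apply Rdiv_lt_0_compat; [apply cond_pos|lra]).
        apply exp_increasing; lra. }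
      assert (C * exp (- (t / 2)) < C * (eps / C)) by (apply Rmult_lt_compat_l; lra).
      replace (C * (eps / C)) with (pos eps) in * by (field; lra). lra. }
  assert (Hlin : is_RInt_gen (Derive F) (at_right 0) (Rbar_locally p_infty)
                   (x * Gamma x - Gamma (x + 1))).
  { apply (is_RInt_gen_ext (V:=R_NormedModule)
      (fun t => x * gamma_integrand x t - gamma_integrand (x + 1) t)).
    - refine (filter_imp _ _ _ Hpos). intros ab Hab t Ht.
      symmetry; apply is_derive_unique, HF; lra.
    - apply (is_RInt_gen_minus (V:=R_NormedModule)); [|exact H2].
      apply (is_RInt_gen_scal (V:=R_NormedModule) _ x). exact H1. }
  apply (is_RInt_gen_unique (V:=R_CompleteNormedModule)) in Hlim.
  apply (is_RInt_gen_unique (V:=R_CompleteNormedModule)) in Hlin.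
  rewrite Hlim in Hlin. lra.
Qed.

(** * Complex power series with real coefficients *)

Lemma is_series_le (a b : nat -> R) (la lb : R) :
  (forall n, a n <= b n) -> is_series a la -> is_series b lb -> la <= lb.
Proof.
  intros H Ha Hb.
  apply (is_lim_seq_le (sum_n a) (sum_n b) la lb).
  - intros n; apply sum_n_m_le; assumption.
  - exact Ha.
  - exact Hb.
Qed.

Lemma is_series_zero : is_series (fun _ : nat => 0) 0.
Proof.
  apply (filterlim_ext (fun _ => 0)); [|apply filterlim_const].
  intros n. rewrite sum_n_const. ring.
Qed.

Definition is_Cseries (a : nat -> C) (s : C) : Prop :=
  is_series (fun n => Re (a n)) (Re s) /\ is_series (fun n => Im (a n)) (Im s).

Lemma Cseries_unique (a : nat -> C) (s : C) : is_Cseries a s -> Cseries a = s.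
Proof.
  intros [H1 H2]. unfold Cseries.
  rewrite (is_series_unique _ _ H1), (is_series_unique _ _ H2).
  destruct s; reflexivity.
Qed.

Lemma is_Cseries_ext (a b : nat -> C) (s : C) :
  (forall n, a n = b n) -> is_Cseries a s -> is_Cseries b s.
Proof.
  intros H [H1 H2]; split; eapply is_series_ext; [|exact H1| |exact H2];
  intros n; cbv beta; rewrite H; reflexivity.
Qed.

Lemma is_Cseries_plus (a b : nat -> C) (s t : C) :
  is_Cseries a s -> is_Cseries b t ->
  is_Cseries (fun n => (a n + b n)%C) (s + t)%C.
Proof.
  intros [H1 H2] [H3 H4]; split.
  - exact (is_series_plus _ _ _ _ H1 H3).
  - exact (is_series_plus _ _ _ _ H2 H4).
Qed.

Lemma is_Cseries_scal (c : C) (a : nat -> C) (s : C) :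
  is_Cseries a s -> is_Cseries (fun n => (c * a n)%C) (c * s)%C.
Proof.
  intros [H1 H2]; split.
  - exact (is_series_minus _ _ _ _ (is_series_scal (Re c) _ _ H1)
             (is_series_scal (Im c) _ _ H2)).
  - exact (is_series_plus _ _ _ _ (is_series_scal (Re c) _ _ H2)
             (is_series_scal (Im c) _ _ H1)).
Qed.

Lemma is_Cseries_minus (a b : nat -> C) (s t : C) :
  is_Cseries a s -> is_Cseries b t ->
  is_Cseries (fun n => (a n - b n)%C) (s - t)%C.
Proof.
  intros Ha Hb. apply is_Cseries_ext with (fun n => a n + (RtoC (-1)) * b n)%C.
  - intros n; ring.
  - replace (s - t)%C with (s + RtoC (-1) * t)%C by ring.
    apply is_Cseries_plus; [|apply is_Cseries_scal]; assumption.
Qed.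

Lemma is_Cseries_incr_1 (a : nat -> C) (s : C) :
  is_Cseries a s -> is_Cseries (fun n => a (S n)) (s - a O)%C.
Proof.
  intros [H1 H2]; split.
  - apply (is_series_incr_1 (fun n => Re (a n))).
    refine (eq_ind_r (is_series _) H1 _).
    unfold Re, Im; destruct s, (a O); simpl. unfold plus; simpl; ring.
  - apply (is_series_incr_1 (fun n => Im (a n))).
    refine (eq_ind_r (is_series _) H2 _).
    unfold Re, Im; destruct s, (a O); simpl. unfold plus; simpl; ring.
Qed.

(* [|s|^2] is the real part of the sum of [Cconj s * a n]. *)
Lemma is_Cseries_Cmod_le (a : nat -> C) (b : nat -> R) (s : C) (l : R) :
  (forall n, Cmod (a n) <= b n) -> is_Cseries a s -> is_series b l -> Cmod s <= l.
Proof.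
  intros Hab Ha Hb.
  assert (Hl : 0 <= l).
  { apply (is_series_le (fun _ => 0) b 0 l).
    - intros n; eapply Rle_trans; [apply Cmod_ge_0|apply Hab].
    - apply is_series_zero.
    - exact Hb. }
  destruct (Cmod_ge_0 s) as [Hs|<-]; [|exact Hl].
  apply Rmult_le_reg_l with (Cmod s); [exact Hs|].
  replace (Cmod s * Cmod s) with (Re (Cconj s * s)%C).
  2:{ rewrite Cmult_comm, <- Cmod2_conj. simpl. ring. }
  apply (is_series_le (fun n => Re (Cconj s * a n)%C) (fun n => Cmod s * b n)).
  - intros n. eapply Rle_trans; [apply Rle_abs|]. eapply Rle_trans; [apply re_le_Cmod|].
    rewrite Cmod_mult, Cmod_conj. apply Rmult_le_compat_l; [lra|apply Hab].
  - exact (proj1 (is_Cseries_scal (Cconj s) _ _ Ha)).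
  - exact (is_series_scal (Cmod s) _ _ Hb).
Qed.

Lemma im_le_Cmod (c : C) : Rabs (Im c) <= Cmod c.
Proof.
  eapply Rle_trans; [|apply Rmax_Cmod]. apply Rmax_r.
Qed.

Lemma ex_series_Re_Im (a : nat -> C) :
  ex_series (fun n => Cmod (a n)) ->
  ex_series (fun n => Rabs (Re (a n))) /\ ex_series (fun n => Rabs (Im (a n))).
Proof.
  intros H; split; refine (ex_series_le (V:=R_CompleteNormedModule) _ _ _ H);
  intros n; change norm with Rabs; cbv beta; rewrite Rabs_Rabsolu.
  - apply re_le_Cmod.
  - apply im_le_Cmod.
Qed.

Lemma Cseries_correct (a : nat -> C) :
  ex_series (fun n => Cmod (a n)) -> is_Cseries a (Cseries a).
Proof.
  intros H. destruct (ex_series_Re_Im _ H) as [H1 H2].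
  split; apply Series_correct, ex_series_Rabs; assumption.
Qed.

Lemma Re_sum_f_R0 (f : nat -> C) (n : nat) :
  Re (sum_n f n) = sum_f_R0 (fun k => Re (f k)) n /\
  Im (sum_n f n) = sum_f_R0 (fun k => Im (f k)) n.
Proof.
  induction n as [|n [IH1 IH2]].
  - rewrite sum_O; split; reflexivity.
  - rewrite sum_Sn. simpl sum_f_R0. rewrite <- IH1, <- IH2. split; reflexivity.
Qed.

(** The real Cauchy product theorem is applied to the four products of real and imaginary parts,
    which inherit absolute convergence from the moduli. *)
Lemma is_Cseries_mult (a b : nat -> C) :
  ex_series (fun n => Cmod (a n)) -> ex_series (fun n => Cmod (b n)) ->
  is_Cseries (fun n => sum_n (fun k => (a k * b (n - k)%nat)%C) n)
    (Cseries a * Cseries b)%C.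
Proof.
  intros Ha Hb.
  destruct (ex_series_Re_Im _ Ha) as [Ha1 Ha2], (ex_series_Re_Im _ Hb) as [Hb1 Hb2].
  destruct (Cseries_correct _ Ha) as [Sa1 Sa2], (Cseries_correct _ Hb) as [Sb1 Sb2].
  split.
  - eapply is_series_ext; [|exact (is_series_minus _ _ _ _
      (is_series_mult _ _ _ _ Sa1 Sb1 Ha1 Hb1) (is_series_mult _ _ _ _ Sa2 Sb2 Ha2 Hb2))].
    intros n. rewrite (proj1 (Re_sum_f_R0 _ n)).
    exact (eq_sym (minus_sum _ _ n)).
  - eapply is_series_ext; [|exact (is_series_plus _ _ _ _
      (is_series_mult _ _ _ _ Sa1 Sb2 Ha1 Hb2) (is_series_mult _ _ _ _ Sa2 Sb1 Ha2 Hb1))].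
    intros n. rewrite (proj2 (Re_sum_f_R0 _ n)).
    exact (eq_sym (plus_sum _ _ n)).
Qed.

Definition CPSeries (a : nat -> R) (z : C) : C :=
  Cseries (fun n => (RtoC (a n) * z ^ n)%C).

Lemma Cmod_pseries_term (x : R) (z : C) (n : nat) :
  Cmod (RtoC x * z ^ n)%C = Rabs (x * Cmod z ^ n).
Proof.
  rewrite Cmod_mult, Cmod_pow, Cmod_R, Rabs_mult.
  rewrite (Rabs_pos_eq (Cmod z ^ n)); [reflexivity|apply pow_le, Cmod_ge_0].
Qed.

Lemma ex_series_Cmod_pseries (a : nat -> R) (z : C) :
  Rbar_lt (Cmod z) (CV_radius a) ->
  ex_series (fun n => Cmod (RtoC (a n) * z ^ n)%C).
Proof.
  intros H. apply (ex_series_ext (fun n => Rabs (a n * Cmod z ^ n))).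
  - intros n; symmetry; apply Cmod_pseries_term.
  - apply CV_disk_inside. rewrite Rabs_pos_eq by apply Cmod_ge_0. exact H.
Qed.

Lemma CPSeries_correct (a : nat -> R) (z : C) :
  Rbar_lt (Cmod z) (CV_radius a) ->
  is_Cseries (fun n => RtoC (a n) * z ^ n)%C (CPSeries a z).
Proof. intros H; apply Cseries_correct, ex_series_Cmod_pseries, H. Qed.

Lemma CPSeries_unique (a : nat -> R) (z s : C) :
  is_Cseries (fun n => RtoC (a n) * z ^ n)%C s -> CPSeries a z = s.
Proof. apply Cseries_unique. Qed.

Lemma CPSeries_ext (a b : nat -> R) (z : C) :
  (forall n, a n = b n) -> CPSeries a z = CPSeries b z.
Proof.
  intros H. unfold CPSeries, Cseries.
  f_equal; apply Series_ext; intros n; rewrite H; reflexivity.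
Qed.

Lemma CPSeries_real (a : nat -> R) (x : R) : CPSeries a (RtoC x) = RtoC (PSeries a x).
Proof.
  unfold CPSeries, Cseries. apply injective_projections; simpl fst; simpl snd.
  - apply Series_ext; intros n. rewrite <- RtoC_pow. simpl. ring.
  - transitivity (Series (fun _ => 0)); [|apply is_series_unique, is_series_zero].
    apply Series_ext; intros n. rewrite <- RtoC_pow. simpl. ring.
Qed.

Lemma sum_n_RtoC (f : nat -> R) (n : nat) :
  sum_n (fun k => RtoC (f k)) n = RtoC (sum_n f n).
Proof.
  induction n as [|n IH].
  - rewrite !sum_O. reflexivity.
  - rewrite !sum_Sn, IH. symmetry. apply RtoC_plus.
Qed.

Lemma CPSeries_mult (a b : nat -> R) (z : C) :
  Rbar_lt (Cmod z) (CV_radius a) -> Rbar_lt (Cmod z) (CV_radius b) ->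
  CPSeries (PS_mult a b) z = (CPSeries a z * CPSeries b z)%C.
Proof.
  intros Ha Hb. apply CPSeries_unique.
  eapply is_Cseries_ext; [|apply is_Cseries_mult; apply ex_series_Cmod_pseries; assumption].
  intros n. unfold PS_mult. rewrite <- sum_n_Reals.
  transitivity (sum_n (fun k => (RtoC (a k * b (n - k)%nat) * z ^ n)%C) n).
  - apply sum_n_ext_loc. intros k Hk.
    replace (z ^ n)%C with (z ^ k * z ^ (n - k))%C.
    + rewrite RtoC_mult. match goal with |- ?x = ?y => change (@eq C x y) end. ring.
    + rewrite <- Cpow_add_r. f_equal. lia.
  - rewrite (sum_n_mult_r (K:=C_Ring) (z ^ n)%C). change mult with Cmult. f_equal.
    apply (sum_n_RtoC (fun k => a k * b (n - k)%nat)).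
Qed.

Lemma CPSeries_lin (c d : R) (a b : nat -> R) (z : C) :
  Rbar_lt (Cmod z) (CV_radius a) -> Rbar_lt (Cmod z) (CV_radius b) ->
  CPSeries (fun n => c * a n + d * b n) z
  = (RtoC c * CPSeries a z + RtoC d * CPSeries b z)%C.
Proof.
  intros Ha Hb. apply CPSeries_unique.
  eapply is_Cseries_ext; [|apply is_Cseries_plus;
    apply is_Cseries_scal, CPSeries_correct; eassumption].
  intros n; cbv beta. rewrite RtoC_plus, !RtoC_mult. ring.
Qed.

Lemma CPSeries_decr_1 (a : nat -> R) (z : C) :
  Rbar_lt (Cmod z) (CV_radius a) ->
  CPSeries a z = (RtoC (a O) + z * CPSeries (fun n => a (S n)) z)%C.
Proof.
  intros Ha.
  assert (H1 : Rbar_lt (Cmod z) (CV_radius (fun n => a (S n)))).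
  { change (fun n => a (S n)) with (PS_decr_1 a). rewrite CV_radius_decr_1. exact Ha. }
  assert (H2 := is_Cseries_incr_1 _ _ (CPSeries_correct a z Ha)).
  assert (H3 := is_Cseries_scal z _ _ (CPSeries_correct _ z H1)).
  apply Cseries_unique in H2. apply Cseries_unique in H3. cbv beta in H2, H3.
  rewrite <- H3.
  replace (Cseries (fun n => z * (RtoC (a (S n)) * z ^ n))%C)
    with (Cseries (fun n => RtoC (a (S n)) * z ^ S n)%C).
  - rewrite H2. simpl Cpow. ring.
  - unfold Cseries. f_equal; apply Series_ext; intros n; f_equal; simpl Cpow; ring.
Qed.

Lemma CPSeries_incr_1 (a : nat -> R) (z : C) :
  Rbar_lt (Cmod z) (CV_radius a) ->
  CPSeries (PS_incr_1 a) z = (z * CPSeries a z)%C.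
Proof.
  intros Ha. rewrite CPSeries_decr_1 by (rewrite CV_radius_incr_1; exact Ha).
  apply Cplus_0_l.
Qed.

(** These are the coefficients of [z] times the derivative; neither differentiation nor a shift
    changes the radius. *)
Lemma CV_radius_index (a : nat -> R) :
  CV_radius (fun n => INR n * a n) = CV_radius a.
Proof.
  rewrite <- (CV_radius_derive a), <- (CV_radius_incr_1 (PS_derive a)).
  apply CV_radius_ext. intros [|n]; [apply Rmult_0_l|reflexivity].
Qed.

Lemma CPSeries_Cmod_le (a : nat -> R) (z : C) :
  (forall n, 0 <= a n) -> Rbar_lt (Cmod z) (CV_radius a) ->
  Cmod (CPSeries a z) <= PSeries a (Cmod z).
Proof.
  intros Hp Ha.
  apply (is_Cseries_Cmod_le _ (fun n => a n * Cmod z ^ n) _ _) with (2 := CPSeries_correct a z Ha).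
  - intros n. rewrite Cmod_pseries_term, Rabs_pos_eq; [lra|].
    apply Rmult_le_pos; [apply Hp|apply pow_le, Cmod_ge_0].
  - apply Series_correct, ex_series_Rabs, CV_disk_inside.
    rewrite Rabs_pos_eq by apply Cmod_ge_0. exact Ha.
Qed.

Lemma Rbar_lt_exists_real (r : R) (l : Rbar) :
  Rbar_lt r l -> exists rho, r < rho /\ Rbar_lt rho l.
Proof.
  destruct l as [l| |]; simpl; intros H.
  - exists ((r + l) / 2); lra.
  - exists (r + 1); split; [lra|exact I].
  - contradiction.
Qed.

(** Induction through the identity [R_(m+1) = y R_m + m z^(m-1) (y - z)^2] for the remainder [R_m]
    of the m-th power. The bound is twice the sharp one, so that its constant is the factor
    occurring in a second derivative at [rho]. *)
Lemma Cpow_Taylor_remainder (z y : C) (rho : R) (n : nat) :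
  Cmod z <= rho -> Cmod y <= rho ->
  Cmod (y ^ S (S n) - z ^ S (S n) - RtoC (INR (S (S n))) * z ^ S n * (y - z))%C
    <= INR (S n) * (INR (S (S n)) * rho ^ n) * Cmod (y - z) ^ 2.
Proof.
  intros Hz Hy.
  assert (Hr : 0 <= rho) by (eapply Rle_trans; [apply Cmod_ge_0|exact Hz]).
  induction n as [|n IH].
  - replace (y ^ 2 - z ^ 2 - RtoC (INR 2) * z ^ 1 * (y - z))%C with ((y - z) ^ 2)%C
      by (simpl; rewrite RtoC_plus; ring).
    rewrite Cmod_pow. simpl. assert (0 <= Cmod (y - z) * (Cmod (y - z) * 1)); [|lra].
    apply (pow_le _ 2), Cmod_ge_0.
  - set (m := S (S n)) in *.
    replace (y ^ S m - z ^ S m - RtoC (INR (S m)) * z ^ m * (y - z))%C with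
      (y * (y ^ m - z ^ m - RtoC (INR m) * z ^ S n * (y - z))
       + RtoC (INR m) * z ^ S n * (y - z) ^ 2)%C.
    2:{ rewrite (S_INR m), RtoC_plus. unfold m. simpl Cpow. ring. }
    eapply Rle_trans; [apply Cmod_triangle|].
    rewrite !Cmod_mult, !Cmod_pow, Cmod_R, (Rabs_pos_eq (INR m)) by apply pos_INR.
    assert (Hd : 0 <= Cmod (y - z) ^ 2) by (apply pow_le, Cmod_ge_0).
    assert (H1 : Cmod y * Cmod (y ^ m - z ^ m - RtoC (INR m) * z ^ S n * (y - z))%C
       <= rho * (INR (S n) * (INR m * rho ^ n) * Cmod (y - z) ^ 2))
      by (apply Rmult_le_compat; auto using Cmod_ge_0).
    assert (H2 : INR m * Cmod z ^ S n * Cmod (y - z) ^ 2 <=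
                 INR m * rho ^ S n * Cmod (y - z) ^ 2).
    { apply Rmult_le_compat_r; [exact Hd|]. apply Rmult_le_compat_l; [apply pos_INR|].
      apply pow_incr; split; [apply Cmod_ge_0|exact Hz]. }
    eapply Rle_trans; [apply Rplus_le_compat; [exact H1|exact H2]|].
    assert (Hm : INR m = INR (S n) + 1) by (unfold m; rewrite (S_INR (S n)); reflexivity).
    rewrite (S_INR m), Hm. simpl pow at 1 3.
    assert (0 <= INR (S n)) by apply pos_INR.
    assert (0 <= rho ^ S n * Cmod (y - z) ^ 2) by (apply Rmult_le_pos; [apply pow_le|]; assumption).
    simpl pow in *. nra.
Qed.

Lemma CPSeries_Taylor_remainder (a : nat -> R) (rho : R) :
  Rbar_lt rho (CV_radius a) ->
  exists K, 0 <= K /\ forall z y, Cmod z <= rho -> Cmod y <= rho ->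
    Cmod (CPSeries a y - CPSeries a z - CPSeries (PS_derive a) z * (y - z))%C
      <= K * Cmod (y - z) ^ 2.
Proof.
  intros Hrho.
  destruct (Rle_or_lt 0 rho) as [Hr|Hr].
  2:{ exists 0; split; [lra|]. intros z y Hz. generalize (Cmod_ge_0 z); lra. }
  assert (Hlt : forall z, Cmod z <= rho -> Rbar_lt (Cmod z) (CV_radius a)).
  { intros z Hz. eapply Rbar_le_lt_trans; [|exact Hrho]. exact Hz. }
  assert (Hs : ex_series (fun n => Rabs (PS_derive (PS_derive a) n * rho ^ n))).
  { apply CV_disk_inside. rewrite !CV_radius_derive, Rabs_pos_eq by assumption. exact Hrho. }
  apply Series_correct in Hs.
  exists (Series (fun n => Rabs (PS_derive (PS_derive a) n * rho ^ n))). split.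
  { apply (is_series_le (fun _ => 0) _ 0 _) with (3 := Hs).
    - intros; apply Rabs_pos.
    - apply is_series_zero. }
  intros z y Hz Hy.
  (* The constant and the linear term have no remainder; they are split off, one before and one
     after subtracting the derivative series. *)
  assert (H1 := is_Cseries_minus _ _ _ _
     (is_Cseries_incr_1 _ _ (CPSeries_correct a y (Hlt y Hy)))
     (is_Cseries_incr_1 _ _ (CPSeries_correct a z (Hlt z Hz)))).
  assert (Hd : is_Cseries (fun n => RtoC (PS_derive a n) * z ^ n)%C (CPSeries (PS_derive a) z))
    by (apply CPSeries_correct; rewrite CV_radius_derive; auto).
  assert (H2 := is_Cseries_incr_1 _ _
     (is_Cseries_minus _ _ _ _ H1 (is_Cseries_scal (y - z)%C _ _ Hd))).
  match type of H2 with is_Cseries _ ?s =>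
    replace (CPSeries a y - CPSeries a z - CPSeries (PS_derive a) z * (y - z))%C with s
  end.
  2:{ unfold PS_derive. change (INR 1) with 1. rewrite Rmult_1_l. simpl Cpow. ring. }
  rewrite (Rmult_comm (Series _)).
  refine (is_Cseries_Cmod_le _ _ _ _ _ H2 (is_series_scal (Cmod (y - z) ^ 2) _ _ Hs)).
  intros n. cbv beta.
  replace (RtoC (a (S (S n))) * y ^ S (S n) - RtoC (a (S (S n))) * z ^ S (S n)
      - (y - z) * (RtoC (PS_derive a (S n)) * z ^ S n))%C
    with (RtoC (a (S (S n))) *
      (y ^ S (S n) - z ^ S (S n) - RtoC (INR (S (S n))) * z ^ S n * (y - z)))%C
    by (unfold PS_derive; rewrite RtoC_mult; ring).
  rewrite Cmod_mult, Cmod_R. change scal with Rmult.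
  eapply Rle_trans.
  - apply Rmult_le_compat_l; [apply Rabs_pos|]. apply (Cpow_Taylor_remainder z y rho n Hz Hy).
  - right. unfold PS_derive. rewrite !Rabs_mult.
    rewrite !(Rabs_pos_eq (INR _)) by apply pos_INR.
    rewrite (Rabs_pos_eq (rho ^ n)) by (apply pow_le; assumption). ring.
Qed.

Lemma is_derive_CPSeries (a : nat -> R) (z : C) :
  Rbar_lt (Cmod z) (CV_radius a) ->
  @is_derive C_AbsRing C_NormedModule (CPSeries a) z (CPSeries (PS_derive a) z).
Proof.
  intros Hz. destruct (Rbar_lt_exists_real _ _ Hz) as (rho & Hz1 & Hrho).
  destruct (CPSeries_Taylor_remainder a rho Hrho) as (K & HK & H).
  split; [apply is_linear_scal_l|].
  intros x Hx.
  replace x with z by (apply (is_filter_lim_locally_unique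
     (V:=AbsRing_NormedModule C_AbsRing)); exact Hx).
  intros eps.
  (* The first bound keeps [y] in the disk of radius [rho], the second makes [K * Cmod (y - z)] at
     most [eps]; [K + 1] is positive even when [K = 0]. *)
  assert (Hd : 0 < Rmin (rho - Cmod z) (eps / (K + 1))).
  { apply Rmin_glb_lt; [lra|]. apply Rdiv_lt_0_compat; [apply cond_pos|lra]. }
  exists (mkposreal _ Hd). intros y Hy.
  change (Cmod (y - z)%C < Rmin (rho - Cmod z) (eps / (K + 1))) in Hy.
  change (Cmod (CPSeries a y - CPSeries a z - (y - z) * CPSeries (PS_derive a) z)%C
     <= eps * Cmod (y - z)%C).
  assert (Hy1 := Rlt_le_trans _ _ _ Hy (Rmin_l _ _)).
  assert (Hy2 := Rlt_le_trans _ _ _ Hy (Rmin_r _ _)).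
  rewrite (Cmult_comm (y - z)%C).
  eapply Rle_trans.
  - apply H; [lra|]. replace y with (z + (y - z))%C by ring.
    eapply Rle_trans; [apply Cmod_triangle|]. lra.
  - simpl. rewrite Rmult_1_r, <- Rmult_assoc.
    apply Rmult_le_compat_r; [apply Cmod_ge_0|].
    assert (0 <= Cmod (y - z)) by apply Cmod_ge_0.
    assert ((K + 1) * Cmod (y - z) <= (K + 1) * (eps / (K + 1)))
      by (apply Rmult_le_compat_l; lra).
    replace ((K + 1) * (eps / (K + 1))) with (pos eps) in * by (field; lra). lra.
Qed.

(** * The Riccati equation for the logarithmic derivative *)

Lemma PS_mult_ext (a b c d : nat -> R) (n : nat) :
  (forall k, (k <= n)%nat -> a k = c k) -> (forall k, (k <= n)%nat -> b k = d k) ->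
  PS_mult a b n = PS_mult c d n.
Proof.
  intros H1 H2. apply sum_eq. intros k Hk. rewrite H1, H2 by lia. reflexivity.
Qed.

Lemma PS_mult_S_l (a b : nat -> R) (n : nat) :
  PS_mult a b (S n) = a O * b (S n) + PS_mult (fun k => a (S k)) b n.
Proof. unfold PS_mult. rewrite decomp_sum by lia. reflexivity. Qed.

Lemma PS_mult_S_r (a b : nat -> R) (n : nat) :
  PS_mult a b (S n) = PS_mult a (fun k => b (S k)) n + a (S n) * b O.
Proof.
  unfold PS_mult. rewrite tech5, Nat.sub_diag. f_equal.
  apply sum_eq. intros k Hk. replace (S n - k)%nat with (S (n - k)) by lia. reflexivity.
Qed.

Lemma PS_mult_plus_l (a b c : nat -> R) (n : nat) :
  PS_mult (fun k => a k + b k) c n = PS_mult a c n + PS_mult b c n.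
Proof.
  unfold PS_mult. rewrite <- plus_sum. apply sum_eq. intros; ring.
Qed.

Lemma PS_mult_plus_r (a b c : nat -> R) (n : nat) :
  PS_mult a (fun k => b k + c k) n = PS_mult a b n + PS_mult a c n.
Proof.
  unfold PS_mult. rewrite <- plus_sum. apply sum_eq. intros; ring.
Qed.

Lemma PS_mult_scal_l (x : R) (a b : nat -> R) (n : nat) :
  PS_mult (fun k => x * a k) b n = x * PS_mult a b n.
Proof.
  unfold PS_mult. rewrite scal_sum. apply sum_eq. intros; ring.
Qed.

(** The induction peels off the first coefficient of [a], so it has to hold for all [a]: the
    hypothesis is used for the shifted sequence. *)
Lemma PS_mult_assoc (a b c : nat -> R) (n : nat) :
  PS_mult (PS_mult a b) c n = PS_mult a (PS_mult b c) n.
Proof.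
  revert a. induction n as [|n IH]; intros a.
  - unfold PS_mult; simpl. ring.
  - rewrite !(PS_mult_S_l _ _ n), <- IH.
    rewrite (PS_mult_ext (fun k => PS_mult a b (S k)) c
      (fun k => a O * b (S k) + PS_mult (fun j => a (S j)) b k) c)
      by (intros; try apply PS_mult_S_l; reflexivity).
    rewrite PS_mult_plus_l, PS_mult_scal_l.
    change (PS_mult a b O) with (a O * b O). ring.
Qed.

(** The Leibniz rule for the operator [z d/dz], which multiplies the n-th coefficient by [n]. *)
Lemma PS_mult_index (a b : nat -> R) (n : nat) :
  INR n * PS_mult a b n =
  PS_mult (fun k => INR k * a k) b n + PS_mult a (fun k => INR k * b k) n.
Proof.
  unfold PS_mult. rewrite <- plus_sum, scal_sum. apply sum_eq. intros k Hk.
  replace (INR n) with (INR k + INR (n - k)); [ring|].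
  rewrite <- plus_INR. f_equal. lia.
Qed.

Fixpoint bcoef (a : R) (n : nat) : R :=
  match n with
  | O => 1
  | S m => bcoef a m / (4 * INR (S m) * (a + INR m))
  end.

Lemma bcoef_S (a : R) (n : nat) :
  bcoef a (S n) = bcoef a n / (4 * INR (S n) * (a + INR n)).
Proof. reflexivity. Qed.

Definition phi (a : R) (n : nat) : R := (-1) ^ n * bcoef a n.

Lemma bcoef_step_pos (a : R) (n : nat) : 0 < a -> 0 < 4 * INR (S n) * (a + INR n).
Proof.
  intros Ha. assert (0 < INR (S n)) by (apply lt_0_INR; lia).
  assert (0 <= INR n) by apply pos_INR.
  apply Rmult_lt_0_compat; lra.
Qed.

Lemma bcoef_pos (a : R) (n : nat) : 0 < a -> 0 < bcoef a n.
Proof.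
  intros Ha. induction n as [|n IH]; [simpl; lra|].
  rewrite bcoef_S. apply Rdiv_lt_0_compat; [exact IH|apply bcoef_step_pos, Ha].
Qed.

(** Bessel's equation [z phi'' + a phi' + phi / 4 = 0], read off coefficient by coefficient. *)
Lemma phi_S (a : R) (n : nat) :
  0 < a -> (a + INR n) * (INR (S n) * phi a (S n)) = - (phi a n / 4).
Proof.
  intros Ha. unfold phi. rewrite bcoef_S. simpl pow.
  assert (0 < INR (S n)) by (apply lt_0_INR; lia).
  assert (0 <= INR n) by apply pos_INR.
  set (p := INR (S n)) in *. field. split; lra.
Qed.

Lemma Rabs_phi (a : R) (n : nat) : 0 < a -> Rabs (phi a n) = bcoef a n.
Proof.
  intros Ha. unfold phi. rewrite Rabs_mult, pow_1_abs.
  rewrite Rabs_pos_eq; [ring|]. apply Rlt_le, bcoef_pos, Ha.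
Qed.

Lemma CV_radius_phi (a : R) : 0 < a -> CV_radius (phi a) = p_infty.
Proof.
  intros Ha. apply CV_radius_infinite_DAlembert.
  - intros n H. assert (H1 := Rabs_phi a n Ha). rewrite H, Rabs_R0 in H1.
    generalize (bcoef_pos a n Ha). lra.
  - apply (is_lim_seq_le_le (fun _ => 0) _ (fun n => / (4 * a) * / INR (S n))).
    + intros n. split; [apply Rabs_pos|].
      assert (Hb := bcoef_pos a n Ha).
      assert (0 < INR (S n)) by (apply lt_0_INR; lia).
      assert (0 <= INR n) by apply pos_INR.
      rewrite Rabs_div.
      2:{ intros H1. assert (H2 := Rabs_phi a n Ha). rewrite H1, Rabs_R0 in H2. lra. }
      rewrite !Rabs_phi by assumption. rewrite bcoef_S. set (p := INR (S n)) in *.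
      replace (bcoef a n / (4 * p * (a + INR n)) / bcoef a n)
        with (/ (4 * p * (a + INR n))) by (field; repeat split; lra).
      rewrite <- Rinv_mult. apply Rinv_le_contravar; [|nra].
      apply Rmult_lt_0_compat; lra.
    + apply is_lim_seq_const.
    + replace (Finite 0) with (Rbar_mult (/ (4 * a)) 0) by (simpl; f_equal; ring).
      apply is_lim_seq_scal_l.
      apply (is_lim_seq_incr_1 (fun n => / INR n)).
      replace (Finite 0) with (Rbar_inv p_infty) by reflexivity.
      apply is_lim_seq_inv; [apply is_lim_seq_INR|discriminate].
Qed.

(** The Riccati recursion calls all smaller indices, so it is not structural in [n]. The argument
    [k] is fuel, and the value is final as soon as [n < k]. *)
Fixpoint riccati_approx (a : R) (k n : nat) : R :=
  match k, n with
  | O, _ => 0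
  | S k', O => / (4 * a)
  | S k', S m => PS_mult (riccati_approx a k') (riccati_approx a k') m / (INR (S m) + a)
  end.

(* Taylor coefficients of [- phi' / phi]. *)
Definition wcoef (a : R) (n : nat) : R := riccati_approx a (S n) n.

Lemma riccati_approx_stable (a : R) (k l n : nat) :
  (n < k)%nat -> (n < l)%nat -> riccati_approx a k n = riccati_approx a l n.
Proof.
  revert l n. induction k as [|k IH]; intros l n Hk Hl; [lia|].
  destruct l as [|l]; [lia|]. destruct n as [|n]; [reflexivity|].
  simpl riccati_approx. f_equal. apply PS_mult_ext; intros j Hj; apply IH; lia.
Qed.

Lemma wcoef_0 (a : R) : wcoef a 0 = / (4 * a).
Proof. reflexivity. Qed.

Lemma wcoef_S (a : R) (n : nat) :
  wcoef a (S n) = PS_mult (wcoef a) (wcoef a) n / (INR (S n) + a).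
Proof.
  change (wcoef a (S n)) with
    (PS_mult (riccati_approx a (S n)) (riccati_approx a (S n)) n / (INR (S n) + a)).
  f_equal. apply PS_mult_ext; intros j Hj;
  apply (riccati_approx_stable a (S n) (S j) j); lia.
Qed.

(** With [q = 1 / (4a)], the convolution giving coefficient [S n] has [S n] terms, each at most
    [q ^ S (S n)]; the divisor [INR (S n) + a] exceeds their number. *)
Lemma wcoef_bounds (a : R) (n : nat) :
  0 < a -> 0 <= wcoef a n <= (/ (4 * a)) ^ S n.
Proof.
  intros Ha. set (q := / (4 * a)).
  assert (Hq : 0 < q) by (apply Rinv_0_lt_compat; lra).
  induction n as [n IH] using lt_wf_ind.
  destruct n as [|n].
  - rewrite wcoef_0. fold q. simpl; lra.
  - rewrite wcoef_S.
    assert (Hn : 0 < INR (S n)) by (apply lt_0_INR; lia).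
    assert (H0 : 0 <= PS_mult (wcoef a) (wcoef a) n).
    { unfold PS_mult. rewrite <- sum_n_Reals.
      apply (Rle_trans _ (sum_n (fun _ => 0) n)).
      - rewrite sum_n_const. lra.
      - rewrite !sum_n_Reals. apply sum_Rle. intros k Hk.
        apply Rmult_le_pos; apply IH; lia. }
    assert (H1 : PS_mult (wcoef a) (wcoef a) n <= INR (S n) * q ^ S (S n)).
    { apply (Rle_trans _ (sum_n (fun _ => q ^ S (S n)) n)).
      - unfold PS_mult. rewrite sum_n_Reals. apply sum_Rle. intros k Hk.
        replace (q ^ S (S n)) with (q ^ S k * q ^ S (n - k))
          by (rewrite <- pow_add; f_equal; lia).
        apply Rmult_le_compat; apply IH; lia.
      - rewrite sum_n_const. lra. }
    split.
    + apply Rle_mult_inv_pos; lra.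
    + apply Rmult_le_reg_r with (INR (S n) + a); [lra|].
      unfold Rdiv. rewrite Rmult_assoc, Rinv_l, Rmult_1_r by lra.
      eapply Rle_trans; [exact H1|].
      assert (0 < q ^ S (S n)) by (apply pow_lt; assumption). nra.
Qed.

Lemma CV_radius_wcoef (a : R) : 0 < a -> Rbar_le (4 * a) (CV_radius (wcoef a)).
Proof.
  intros Ha. apply CV_radius_bounded. exists (/ (4 * a)). intros n.
  destruct (wcoef_bounds a n Ha) as [H1 H2].
  assert (0 < (4 * a) ^ n) by (apply pow_lt; lra).
  rewrite Rabs_pos_eq by (apply Rmult_le_pos; lra).
  apply Rle_trans with ((/ (4 * a)) ^ S n * (4 * a) ^ n).
  - apply Rmult_le_compat_r; lra.
  - right. simpl. rewrite Rmult_assoc, <- Rpow_mult_distr, Rinv_l, pow1 by lra. ring.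
Qed.

(** Let [W] have the coefficients [wcoef]. The defect [y = phi' + W phi] solves the linear equation
    [z y' + a y = z W y] with [y(0) = 0], by Bessel's equation and the Riccati recursion, and this
    forces all its coefficients to vanish. *)
Lemma wcoef_phi (a : R) (n : nat) :
  0 < a -> PS_mult (wcoef a) (phi a) n = - PS_derive (phi a) n.
Proof.
  intros Ha.
  set (y := fun n => PS_derive (phi a) n + PS_mult (wcoef a) (phi a) n).
  assert (H0 : forall n, (INR n + a) * PS_derive (phi a) n = - (phi a n / 4)).
  { intros m. rewrite Rplus_comm. apply phi_S, Ha. }
  assert (Hy0 : y O = 0).
  { unfold y. assert (H := H0 O). change (INR 0) with 0 in H.
    assert (Hd : PS_derive (phi a) 0 = - (phi a 0 / 4) / a)
      by (rewrite <- H; field; lra).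
    rewrite Hd. unfold PS_mult; simpl. rewrite wcoef_0. field. lra. }
  assert (HyS : forall m, (INR (S m) + a) * y (S m) = PS_mult (wcoef a) y m).
  { intros m. unfold y at 1. rewrite Rmult_plus_distr_l, H0.
    rewrite (Rmult_plus_distr_r (INR (S m))), PS_mult_index.
    rewrite <- PS_mult_scal_l.
    transitivity (- (phi a (S m) / 4)
       + (PS_mult (fun k => INR k * wcoef a k + a * wcoef a k) (phi a) (S m)
          + PS_mult (wcoef a) (fun k => INR k * phi a k) (S m))).
    { rewrite PS_mult_plus_l. ring. }
    rewrite PS_mult_S_l, PS_mult_S_r.
    unfold y. rewrite PS_mult_plus_r, <- PS_mult_assoc.
    rewrite (PS_mult_ext (fun k => INR (S k) * wcoef a (S k) + a * wcoef a (S k)) (phi a)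
       (PS_mult (wcoef a) (wcoef a)) (phi a)).
    2:{ intros k _. rewrite wcoef_S. assert (0 <= INR (S k)) by apply pos_INR. field; lra. }
    2:{ reflexivity. }
    rewrite wcoef_0. change (INR 0) with 0. unfold PS_derive.
    set (p := INR (S m)) in *. field. lra. }
  assert (Hy : forall m, y m = 0).
  { induction m as [[|m] IH] using lt_wf_ind; [exact Hy0|].
    apply Rmult_eq_reg_l with (INR (S m) + a).
    - rewrite HyS, Rmult_0_r. unfold PS_mult.
      rewrite (sum_eq _ (fun _ => 0 * 0)).
      + rewrite <- scal_sum. ring.
      + intros k Hk. rewrite (IH (m - k)%nat) by lia. ring.
    - assert (0 <= INR (S m)) by apply pos_INR. lra. }
  specialize (Hy n). unfold y in Hy. lra.
Qed.

(* With [a = nu + 1], these are the coefficients of [bessel_h nu] and of its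
   first two derivatives. *)
Definition h_coef (a : R) : nat -> R := PS_incr_1 (phi a).
Definition g_coef (a : R) : nat -> R := PS_derive (h_coef a).
Definition dg_coef (a : R) : nat -> R := PS_derive (g_coef a).

Lemma entire_phi (a x : R) : 0 < a -> Rbar_lt x (CV_radius (phi a)).
Proof. intros Ha. rewrite CV_radius_phi by exact Ha. exact I. Qed.

Lemma entire_dphi (a x : R) : 0 < a -> Rbar_lt x (CV_radius (PS_derive (phi a))).
Proof. rewrite CV_radius_derive. apply entire_phi. Qed.

Lemma entire_h (a x : R) : 0 < a -> Rbar_lt x (CV_radius (h_coef a)).
Proof. unfold h_coef. rewrite CV_radius_incr_1. apply entire_phi. Qed.

Lemma entire_g (a x : R) : 0 < a -> Rbar_lt x (CV_radius (g_coef a)).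
Proof. unfold g_coef. rewrite CV_radius_derive. apply entire_h. Qed.

Lemma entire_dg (a x : R) : 0 < a -> Rbar_lt x (CV_radius (dg_coef a)).
Proof. unfold dg_coef. rewrite CV_radius_derive. apply entire_g. Qed.

Lemma g_coef_E (a : R) (n : nat) : g_coef a n = INR (S n) * phi a n.
Proof. reflexivity. Qed.

Lemma h_series (a : R) (z : C) : 0 < a ->
  CPSeries (h_coef a) z = (z * CPSeries (phi a) z)%C.
Proof. intros Ha; apply CPSeries_incr_1, entire_phi, Ha. Qed.

Lemma g_series (a : R) (z : C) : 0 < a ->
  CPSeries (g_coef a) z = (CPSeries (phi a) z + z * CPSeries (PS_derive (phi a)) z)%C.
Proof.
  intros Ha.
  rewrite (CPSeries_ext _ (fun n => 1 * phi a n + 1 * (INR n * phi a n))).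
  2:{ intros n. rewrite g_coef_E, S_INR. ring. }
  rewrite CPSeries_lin by (try rewrite CV_radius_index; apply entire_phi, Ha).
  rewrite (CPSeries_decr_1 (fun n => INR n * phi a n))
    by (rewrite CV_radius_index; apply entire_phi, Ha).
  change (INR 0) with 0. rewrite Rmult_0_l.
  change (fun n => INR (S n) * phi a (S n)) with (PS_derive (phi a)). ring.
Qed.

(* Bessel's equation turns [z phi''] into [- a phi' - phi / 4]. *)
Lemma dg_series (a : R) (z : C) : 0 < a ->
  CPSeries (dg_coef a) z =
  (RtoC (2 - a) * CPSeries (PS_derive (phi a)) z - RtoC (/ 4) * CPSeries (phi a) z)%C.
Proof.
  intros Ha.
  rewrite (CPSeries_ext _
    (fun n => (2 - a) * PS_derive (phi a) n + (- / 4) * phi a n)).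
  - rewrite CPSeries_lin by (apply entire_dphi, Ha || apply entire_phi, Ha).
    rewrite RtoC_opp. ring.
  - intros n. unfold dg_coef. unfold PS_derive at 1. rewrite g_coef_E.
    replace (- / 4 * phi a n) with (- (phi a n / 4)) by field.
    rewrite <- (phi_S a n Ha). unfold PS_derive. rewrite !S_INR. ring.
Qed.

(** * Logarithmic derivatives as functions on the disk of radius [4 * a] *)

Definition Wser (a : R) : C -> C := CPSeries (wcoef a).
(** This is [z W'], kept as a series because its coefficients are visibly nonnegative. *)
Definition Tser (a : R) : C -> C := CPSeries (fun n => INR n * wcoef a n).

Lemma CV_wcoef (a : R) (z : C) :
  0 < a -> Cmod z < 4 * a -> Rbar_lt (Cmod z) (CV_radius (wcoef a)).
Proof.
  intros Ha H. eapply Rbar_lt_le_trans; [|apply CV_radius_wcoef, Ha]. exact H.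
Qed.

Lemma dphi_series (a : R) (z : C) : 0 < a -> Cmod z < 4 * a ->
  CPSeries (PS_derive (phi a)) z = (- (Wser a z * CPSeries (phi a) z))%C.
Proof.
  intros Ha Hz. unfold Wser.
  rewrite <- CPSeries_mult by (apply CV_wcoef || apply entire_phi; assumption).
  rewrite (CPSeries_ext _ _ z (fun n => wcoef_phi a n Ha)).
  rewrite (CPSeries_ext (fun n => - PS_derive (phi a) n)
     (fun n => (-1) * PS_derive (phi a) n + 0 * PS_derive (phi a) n)) by (intros; ring).
  rewrite CPSeries_lin by (apply entire_dphi, Ha). ring.
Qed.

Lemma Riccati_series (a : R) (z : C) : 0 < a -> Cmod z < 4 * a ->
  (Tser a z + RtoC a * Wser a z = RtoC (/ 4) + z * Wser a z ^ 2)%C.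
Proof.
  intros Ha Hz. assert (Hw := CV_wcoef a z Ha Hz).
  unfold Tser, Wser.
  transitivity (CPSeries (fun n => 1 * (INR n * wcoef a n) + a * wcoef a n) z).
  { rewrite CPSeries_lin by (try rewrite CV_radius_index; exact Hw). ring. }
  rewrite CPSeries_decr_1.
  - rewrite (CPSeries_ext _ (PS_mult (wcoef a) (wcoef a))).
    + rewrite CPSeries_mult by exact Hw. rewrite wcoef_0. change (INR 0) with 0.
      replace (1 * (0 * / (4 * a)) + a * / (4 * a)) with (/ 4) by (field; lra).
      simpl Cpow. ring.
    + intros n. rewrite wcoef_S. assert (0 <= INR (S n)) by apply pos_INR. field; lra.
  - eapply Rbar_lt_le_trans; [|apply CV_radius_plus].
    apply Rbar_min_case.
    + change (Rbar_lt (Cmod z) (CV_radius (PS_scal 1 (fun n => INR n * wcoef a n)))).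
      rewrite CV_radius_scal by lra. rewrite CV_radius_index. exact Hw.
    + change (Rbar_lt (Cmod z) (CV_radius (PS_scal a (wcoef a)))).
      rewrite CV_radius_scal by lra. exact Hw.
Qed.

Lemma g_series_factor (a : R) (z : C) : 0 < a -> Cmod z < 4 * a ->
  CPSeries (g_coef a) z = (CPSeries (phi a) z * (1 - z * Wser a z))%C.
Proof.
  intros Ha Hz. rewrite g_series, dphi_series by assumption. ring.
Qed.

(** Bessel's equation gives [g' = - phi ((2 - a) W + 1/4)]. The Riccati equation then trades [a W]
    for [1/4 + z W^2 - T], which removes [a] and every negative constant: [W (1 - z W) + (W + T)]
    remains. *)
Lemma dg_series_factor (a : R) (z : C) : 0 < a -> Cmod z < 4 * a ->
  CPSeries (dg_coef a) z =
  (- (CPSeries (phi a) z *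
      (Wser a z * (1 - z * Wser a z) + (Wser a z + Tser a z))))%C.
Proof.
  intros Ha Hz. rewrite dg_series, dphi_series by assumption.
  replace (Tser a z) with (RtoC (/ 4) + z * Wser a z ^ 2 - RtoC a * Wser a z)%C.
  - rewrite RtoC_minus. simpl Cpow. ring.
  - rewrite <- Riccati_series by assumption. ring.
Qed.

Lemma log_derivative_g (a : R) (z : C) : 0 < a -> Cmod z < 4 * a ->
  CPSeries (g_coef a) z <> 0 ->
  (z * CPSeries (dg_coef a) z / CPSeries (g_coef a) z =
   - (z * Wser a z + z * (Wser a z + Tser a z) / (1 - z * Wser a z)))%C.
Proof.
  intros Ha Hz Hg. rewrite dg_series_factor by assumption.
  rewrite g_series_factor in * by assumption.
  assert (CPSeries (phi a) z <> 0) by (intros E; apply Hg; rewrite E; ring).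
  assert (1 - z * Wser a z <> 0)%C by (intros E; apply Hg; rewrite E; ring).
  field. split; assumption.
Qed.

(** For [a > 3/4] the ratio [q = 1 / (4a)] is below [1/3], so the majorant [q + q^2 + ...] sums to
    less than [1/2]. This keeps [1 - z W] away from 0 on the closed disk. *)
Lemma PSeries_wcoef_bound (a x : R) : 3 / 4 < a -> 0 <= x <= 1 ->
  0 <= PSeries (wcoef a) x <= / 2.
Proof.
  intros Ha Hx.
  assert (Hq : 0 < / (4 * a) < / 3).
  { split; [apply Rinv_0_lt_compat; lra|apply Rinv_lt_contravar; lra]. }
  set (q := / (4 * a)) in *.
  assert (Hw : is_series (fun n => wcoef a n * x ^ n) (PSeries (wcoef a) x)).
  { apply Series_correct, ex_series_Rabs, CV_disk_inside.
    eapply Rbar_lt_le_trans; [|apply CV_radius_wcoef; lra].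
    simpl. rewrite Rabs_pos_eq; lra. }
  assert (Hb : forall n, 0 <= wcoef a n * x ^ n <= q ^ S n).
  { intros n. destruct (wcoef_bounds a n ltac:(lra)) as [H1 H2]. fold q in H2.
    assert (0 <= x ^ n <= 1)
      by (split; [apply pow_le; lra|rewrite <- (pow1 n); apply pow_incr; lra]).
    split; [apply Rmult_le_pos; lra|nra]. }
  split.
  - apply (is_series_le _ _ _ _ (fun n => proj1 (Hb n)) is_series_zero Hw).
  - assert (Hg := is_series_scal q _ _ (is_series_geom q ltac:(rewrite Rabs_pos_eq; lra))).
    eapply Rle_trans; [apply (is_series_le _ _ _ _ (fun n => proj2 (Hb n)) Hw Hg)|].
    change scal with Rmult. apply Rmult_le_reg_r with (1 - q); [lra|].
    rewrite Rmult_assoc, Rinv_l by lra. lra.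
Qed.

(* The functions [Wser] and [Tser] have nonnegative Taylor coefficients, so that
   replacing [z] by [Cmod z] in the formula for [z g' / g] increases its modulus. *)
Lemma log_derivative_g_Cmod_le (a : R) (z : C) : 3 / 4 < a -> Cmod z <= 1 ->
  CPSeries (g_coef a) z <> 0 -> PSeries (g_coef a) (Cmod z) <> 0 ->
  Cmod (z * CPSeries (dg_coef a) z / CPSeries (g_coef a) z)
  <= - (Cmod z * PSeries (dg_coef a) (Cmod z) / PSeries (g_coef a) (Cmod z)).
Proof.
  intros Ha Hz Hg Hgr. set (r := Cmod z) in *.
  assert (Hr0 : 0 <= r) by apply Cmod_ge_0.
  assert (Hrr : Cmod (RtoC r) = r) by (rewrite Cmod_R; apply Rabs_pos_eq, Hr0).
  set (w := PSeries (wcoef a) r). set (t := PSeries (fun n => INR n * wcoef a n) r).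
  destruct (PSeries_wcoef_bound a r Ha (conj Hr0 Hz)) as [Hw0 Hw1]. fold w in Hw0, Hw1.
  assert (Hrw : 0 <= r * w <= / 2) by nra.
  assert (HW : Cmod (Wser a z) <= w).
  { apply CPSeries_Cmod_le; [intros n; apply wcoef_bounds; lra|].
    apply CV_wcoef; fold r; lra. }
  assert (HT : Cmod (Tser a z) <= t).
  { apply CPSeries_Cmod_le.
    - intros n. apply Rmult_le_pos; [apply pos_INR|apply wcoef_bounds; lra].
    - rewrite CV_radius_index. apply CV_wcoef; fold r; lra. }
  assert (Hreal : - (r * PSeries (dg_coef a) r / PSeries (g_coef a) r)
                  = r * w + r * (w + t) / (1 - r * w)).
  { apply RtoC_inj.
    assert (E := log_derivative_g a (RtoC r) ltac:(lra) ltac:(rewrite Hrr; lra)).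
    unfold Wser, Tser in E. rewrite !CPSeries_real in E. fold w t in E.
    assert (Hne : RtoC (PSeries (g_coef a) r) <> 0)
      by (intros H; apply Hgr, RtoC_inj, H).
    specialize (E Hne).
    rewrite RtoC_opp, RtoC_div, RtoC_mult, E by exact Hgr.
    rewrite RtoC_plus, RtoC_div by lra.
    rewrite !RtoC_mult, RtoC_plus, RtoC_minus, RtoC_mult. ring. }
  rewrite Hreal, log_derivative_g by (try assumption; fold r; lra).
  rewrite Cmod_opp.
  eapply Rle_trans; [apply Cmod_triangle|].
  assert (HzW : Cmod (z * Wser a z) <= r * w).
  { rewrite Cmod_mult. fold r. apply Rmult_le_compat_l; assumption. }
  assert (Hden : 1 - r * w <= Cmod (1 - z * Wser a z)).
  { assert (H := Cmod_triangle (1 - z * Wser a z) (z * Wser a z)).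
    replace (1 - z * Wser a z + z * Wser a z)%C with (RtoC 1) in H by ring.
    rewrite Cmod_1 in H. lra. }
  apply Rplus_le_compat; [exact HzW|].
  assert (Hne : (1 - z * Wser a z)%C <> 0).
  { intros E. rewrite E, Cmod_0 in Hden. lra. }
  rewrite Cmod_div by exact Hne. rewrite Cmod_mult. fold r.
  assert (Ht0 : 0 <= t) by (eapply Rle_trans; [apply Cmod_ge_0|exact HT]).
  apply Rmult_le_compat.
  - apply Rmult_le_pos; [exact Hr0|apply Cmod_ge_0].
  - apply Rlt_le, Rinv_0_lt_compat. lra.
  - apply Rmult_le_compat_l; [exact Hr0|].
    eapply Rle_trans; [apply Cmod_triangle|lra].
  - apply Rinv_le_contravar; lra.
Qed.

(** * Monotonicity in the variable and in the parameter *)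

(** Leibniz's enclosure; that the terms tend to 0 follows from the assumed convergence. *)
Lemma alternating_series_bounds (d : nat -> R) (l : R) (N : nat) :
  (forall n, d (S n) <= d n) -> is_series (fun n => (-1) ^ n * d n) l ->
  sum_f_R0 (tg_alt d) (S (2 * N)) <= l <= sum_f_R0 (tg_alt d) (2 * N).
Proof.
  intros Hd Hl. apply alternated_series_ineq; [exact Hd| |].
  - apply is_lim_seq_Reals. apply is_lim_seq_abs_0.
    assert (H := ex_series_lim_0 _ (ex_intro _ l Hl)).
    apply is_lim_seq_abs_0 in H. revert H. apply is_lim_seq_ext.
    intros n. rewrite Rabs_mult, pow_1_abs. ring.
  - apply is_lim_seq_Reals. apply (is_lim_seq_ext (sum_n (fun n => (-1) ^ n * d n))).
    + intros n. rewrite sum_n_Reals. reflexivity.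
    + exact Hl.
Qed.

Lemma alternating_series_pos (d : nat -> R) (l : R) :
  (forall n, d (S n) < d n) -> is_series (fun n => (-1) ^ n * d n) l ->
  0 < l <= d O.
Proof.
  intros Hd Hl.
  destruct (alternating_series_bounds d l 0 (fun n => Rlt_le _ _ (Hd n)) Hl) as [H1 H2].
  unfold tg_alt in *; simpl in *. specialize (Hd O). lra.
Qed.

(** A common condition on the weights of [g], [x g'] and [F]. It starts at index 1 because the
    weight [n (n + 1)] vanishes at 0; the same weight attains the factor 3, going from 2 to 6. *)
Definition mild_growth (P : nat -> R) : Prop :=
  forall n, 0 < P (S n) /\ P (S (S n)) <= 3 * P (S n).

(** From index 1 on, one step divides [bcoef] by more than [4 * 2 * 1 = 8], whatever [a > 0], while
    the weight grows at most threefold; [3 / 8 < 1 / 2]. *)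
Lemma mild_growth_ratio (P : nat -> R) (a : R) (n : nat) : mild_growth P -> 0 < a ->
  P (S (S n)) * bcoef a (S (S n)) < P (S n) * bcoef a (S n) / 2.
Proof.
  intros HP Ha. destruct (HP n) as [H1 H2].
  rewrite (bcoef_S a (S n)).
  assert (Hb := bcoef_pos a (S n) Ha).
  assert (Hn : 2 <= INR (S (S n))) by (rewrite !S_INR; generalize (pos_INR n); lra).
  assert (Hm : 1 <= INR (S n)) by (rewrite S_INR; generalize (pos_INR n); lra).
  set (p := INR (S (S n))) in *. set (q := INR (S n)) in *. set (b := bcoef a (S n)) in *.
  apply Rmult_lt_reg_r with (4 * p * (a + q)).
  { apply Rmult_lt_0_compat; lra. }
  replace (P (S (S n)) * (b / (4 * p * (a + q))) * (4 * p * (a + q))) with (P (S (S n)) * b)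
    by (field; lra).
  assert (8 < 4 * p * (a + q)) by nra.
  assert (0 < P (S n) * b) by (apply Rmult_lt_0_compat; assumption).
  assert (P (S (S n)) * b <= 3 * (P (S n) * b)) by (apply (Rmult_le_compat_r b) in H2; lra).
  nra.
Qed.

(** The factor 2 is what the gain [1 / 2] in [mild_growth_ratio] compensates, so weighted
    differences of powers still decrease. *)
Lemma pow_diff_ratio (x y : R) (n : nat) : 0 <= x < y -> y <= 1 ->
  0 < y ^ S n - x ^ S n /\
  y ^ S (S n) - x ^ S (S n) <= 2 * (y ^ S n - x ^ S n).
Proof.
  intros Hx Hy.
  assert (H : (y - x) * x ^ n <= y ^ S n - x ^ S n /\ 0 < y ^ S n - x ^ S n).
  { induction n as [|n [IH1 IH2]]; [simpl; lra|].
    assert (0 <= x ^ S n) by (apply pow_le; lra).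
    replace (y ^ S (S n) - x ^ S (S n)) with
      (y * (y ^ S n - x ^ S n) + (y - x) * x ^ S n) by (simpl; ring).
    split; nra. }
  destruct H as [H1 H2]. split; [exact H2|].
  assert (0 <= x ^ n) by (apply pow_le; lra).
  replace (y ^ S (S n) - x ^ S (S n)) with
      (y * (y ^ S n - x ^ S n) + x * ((y - x) * x ^ n)) by (simpl; ring).
  nra.
Qed.

(** Removing the constant term, which is [P O] for every [a] and [x], leaves an alternating series;
    the sign change makes it start with a plus. *)
Lemma weighted_series_tail (P : nat -> R) (a x l : R) :
  is_series (fun n => P n * phi a n * x ^ n) l ->
  is_series (fun n => (-1) ^ n * (P (S n) * bcoef a (S n) * x ^ S n)) (P O - l).
Proof.
  intros H.
  replace (P O - l) with (scal (-1) (l - P O)) by (unfold scal; simpl; unfold mult; simpl; ring).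
  apply (is_series_ext (fun n => scal (-1) (P (S n) * phi a (S n) * x ^ S n))).
  - intros n. unfold scal, phi; simpl. unfold mult; simpl. ring.
  - apply (is_series_scal (K:=R_AbsRing) (V:=R_NormedModule)).
    apply (is_series_incr_1 (fun n => P n * phi a n * x ^ n)).
    refine (eq_ind_r (is_series _) H _).
    unfold plus, phi; simpl. ring.
Qed.

Lemma weighted_series_decreasing (P : nat -> R) (a x y lx ly : R) :
  mild_growth P -> 0 < a -> 0 <= x < y -> y <= 1 ->
  is_series (fun n => P n * phi a n * x ^ n) lx ->
  is_series (fun n => P n * phi a n * y ^ n) ly -> ly < lx.
Proof.
  intros HP Ha Hx Hy Sx Sy.
  apply weighted_series_tail in Sx. apply weighted_series_tail in Sy.
  assert (HS := is_series_minus _ _ _ _ Sy Sx).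
  apply (is_series_ext _ (fun n => (-1) ^ n *
     (P (S n) * bcoef a (S n) * (y ^ S n - x ^ S n)))) in HS.
  2:{ intros n. unfold plus, opp; simpl. ring. }
  apply alternating_series_pos in HS.
  - unfold plus, opp in HS; simpl in HS. lra.
  - intros n. destruct (pow_diff_ratio x y n Hx Hy) as [H1 H2].
    destruct (pow_diff_ratio x y (S n) Hx Hy) as [H3 _].
    assert (H4 := mild_growth_ratio P a n HP Ha).
    set (A := P (S (S n)) * bcoef a (S (S n))) in *.
    set (B := P (S n) * bcoef a (S n)) in *.
    set (u := y ^ S (S n) - x ^ S (S n)) in *.
    set (v := y ^ S n - x ^ S n) in *.
    assert (A * u < B / 2 * u) by (apply Rmult_lt_compat_r; assumption).
    assert (0 <= B).
    { apply Rmult_le_pos; [apply Rlt_le, HP|apply Rlt_le, bcoef_pos, Ha]. }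
    nra.
Qed.

Lemma bcoef_decreasing (a b : R) (n : nat) : 0 < a < b -> bcoef b n <= bcoef a n.
Proof.
  intros Hab. induction n as [|n IH]; [simpl; lra|].
  rewrite !bcoef_S. apply Rmult_le_compat.
  - apply Rlt_le, bcoef_pos; lra.
  - apply Rlt_le, Rinv_0_lt_compat, bcoef_step_pos; lra.
  - exact IH.
  - apply Rinv_le_contravar; [apply bcoef_step_pos; lra|].
    assert (0 < INR (S n)) by (apply lt_0_INR; lia).
    apply Rmult_le_compat_l; lra.
Qed.

(* [(p - k / (s + 1)) / s = (p - k) / s + k / (s + 1)] is decreasing in [s]. *)
Lemma bcoef_pair_decreasing (P : nat -> R) (a b : R) (n : nat) :
  mild_growth P -> 0 < a < b ->
  P (S n) * bcoef b (S n) - P (S (S n)) * bcoef b (S (S n)) <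
  P (S n) * bcoef a (S n) - P (S (S n)) * bcoef a (S (S n)).
Proof.
  intros HP Hab. destruct (HP n) as [H1 H2]. destruct (HP (S n)) as [H3 _].
  assert (Hn : 0 <= INR n) by apply pos_INR.
  assert (Hp1 : INR (S n) = INR n + 1) by apply S_INR.
  assert (Hp2 : INR (S (S n)) = INR n + 2) by (rewrite !S_INR; ring).
  set (p := P (S n)) in *. set (k := P (S (S n)) / (4 * (INR n + 2))).
  assert (Hk : 0 <= k < p).
  { unfold k; split; [apply Rlt_le, Rdiv_lt_0_compat; lra|].
    apply Rmult_lt_reg_r with (4 * (INR n + 2)); [lra|].
    unfold Rdiv; rewrite Rmult_assoc, Rinv_l by lra. nra. }
  assert (HD : forall c, 0 < c ->
    p * bcoef c (S n) - P (S (S n)) * bcoef c (S (S n)) =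
    bcoef c n / (4 * (INR n + 1)) * ((p - k) / (c + INR n) + k / (c + INR n + 1))).
  { intros c Hc. rewrite !bcoef_S, Hp1, Hp2. unfold k. field. repeat split; lra. }
  rewrite !HD by lra.
  assert (Hb := bcoef_decreasing a b n Hab). assert (Hb0 := bcoef_pos b n ltac:(lra)).
  assert (E1 : (p - k) / (b + INR n) < (p - k) / (a + INR n)).
  { apply Rmult_lt_compat_l; [lra|]. apply Rinv_lt_contravar; [|lra].
    apply Rmult_lt_0_compat; lra. }
  assert (E2 : k / (b + INR n + 1) <= k / (a + INR n + 1)).
  { apply Rmult_le_compat_l; [lra|]. apply Rinv_le_contravar; lra. }
  assert (E3 : 0 < (p - k) / (b + INR n)) by (apply Rdiv_lt_0_compat; lra).
  assert (E4 : 0 <= k / (b + INR n + 1)) by (apply Rle_mult_inv_pos; lra).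
  assert (E5 : bcoef b n / (4 * (INR n + 1)) <= bcoef a n / (4 * (INR n + 1))).
  { apply Rmult_le_compat_r; [apply Rlt_le, Rinv_0_lt_compat; lra|exact Hb]. }
  assert (E6 : 0 < bcoef b n / (4 * (INR n + 1))) by (apply Rdiv_lt_0_compat; lra).
  apply Rlt_le_trans with
    (bcoef b n / (4 * (INR n + 1)) * ((p - k) / (a + INR n) + k / (a + INR n + 1))).
  - apply Rmult_lt_compat_l; lra.
  - apply Rmult_le_compat_r; lra.
Qed.

(** The termwise difference alternates with decreasing terms by [bcoef_pair_decreasing], so its sum
    lies between 0 and its first term. The lower bound gives monotonicity in the parameter, the
    upper one continuity. *)
Lemma weighted_series_increasing_param (P : nat -> R) (a b la lb : R) :
  mild_growth P -> 0 < a < b ->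
  is_series (fun n => P n * phi a n * 1 ^ n) la ->
  is_series (fun n => P n * phi b n * 1 ^ n) lb ->
  0 < lb - la <= P 1%nat / 4 * (/ a - / b).
Proof.
  intros HP Hab Sa Sb.
  apply weighted_series_tail in Sa. apply weighted_series_tail in Sb.
  assert (HS := is_series_minus _ _ _ _ Sa Sb).
  apply (is_series_ext _ (fun n => (-1) ^ n *
     (P (S n) * bcoef a (S n) - P (S n) * bcoef b (S n)))) in HS.
  2:{ intros n. rewrite pow1. unfold plus, opp; simpl. ring. }
  apply alternating_series_pos in HS.
  - unfold plus, opp in HS; simpl in HS.
    replace (P 1%nat / 4 * (/ a - / b)) with
      (P 1%nat * (1 / (4 * 1 * (a + 0))) - P 1%nat * (1 / (4 * 1 * (b + 0))))
      by (field; lra).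
    lra.
  - intros n. assert (H := bcoef_pair_decreasing P a b n HP Hab). lra.
Qed.

(** * The functions [g] and [F] on [0,1], and the root of [F] in the parameter *)

Definition g_fun (a x : R) : R := PSeries (g_coef a) x.
(* Where [h' > 0], the condition [1 + x h'' / h' > alpha] says [F_fun > 0]. *)
Definition F_fun (alpha a x : R) : R :=
  x * PSeries (dg_coef a) x + (1 - alpha) * g_fun a x.

Lemma is_series_PSeries (c : nat -> R) (x : R) :
  Rbar_lt (Rabs x) (CV_radius c) -> is_series (fun n => c n * x ^ n) (PSeries c x).
Proof. intros H. apply Series_correct, ex_series_Rabs, CV_disk_inside, H. Qed.

Lemma is_series_g (a x : R) : 0 < a ->
  is_series (fun n => INR (S n) * phi a n * x ^ n) (g_fun a x).
Proof. intros Ha. apply (is_series_PSeries (g_coef a)), entire_g, Ha. Qed.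

Lemma is_series_dg (a x : R) : 0 < a ->
  is_series (fun n => INR n * INR (S n) * phi a n * x ^ n) (x * PSeries (dg_coef a) x).
Proof.
  intros Ha.
  assert (H := is_series_scal x _ _ (is_series_PSeries (dg_coef a) x (entire_dg a _ Ha))).
  apply is_series_decr_1.
  match goal with |- is_series _ ?l => replace l with (x * PSeries (dg_coef a) x) end.
  - revert H. apply is_series_ext. intros n.
    unfold dg_coef. unfold PS_derive at 1. rewrite g_coef_E.
    unfold scal; simpl pow; simpl. unfold mult; simpl. ring.
  - unfold plus, opp; simpl. ring.
Qed.

Lemma is_series_F (alpha a x : R) : 0 < a ->
  is_series (fun n => INR (S n) * (INR (S n) - alpha) * phi a n * x ^ n) (F_fun alpha a x).
Proof.
  intros Ha.
  assert (H := is_series_plus _ _ _ _ (is_series_dg a x Ha)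
    (is_series_scal (1 - alpha) _ _ (is_series_g a x Ha))).
  revert H. apply is_series_ext. intros n.
  change plus with Rplus. change scal with Rmult. cbv beta. rewrite S_INR.
  match goal with |- ?u = ?v => change (@eq R u v) end. ring.
Qed.

Lemma mild_growth_g : mild_growth (fun n => INR (S n)).
Proof. intros n. rewrite !S_INR. generalize (pos_INR n). lra. Qed.

Lemma mild_growth_dg : mild_growth (fun n => INR n * INR (S n)).
Proof. intros n. rewrite !S_INR. generalize (pos_INR n). split; nra. Qed.

Lemma mild_growth_F (alpha : R) : 0 <= alpha < 1 ->
  mild_growth (fun n => INR (S n) * (INR (S n) - alpha)).
Proof. intros H n. rewrite !S_INR. generalize (pos_INR n). split; nra. Qed.

Lemma g_fun_decreasing (a x y : R) : 0 < a -> 0 <= x < y -> y <= 1 ->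
  g_fun a y < g_fun a x.
Proof.
  intros Ha Hx Hy.
  exact (weighted_series_decreasing _ a x y _ _ mild_growth_g Ha Hx Hy
    (is_series_g a x Ha) (is_series_g a y Ha)).
Qed.

Lemma dg_neg (a x : R) : 0 < a -> 0 < x <= 1 -> x * PSeries (dg_coef a) x < 0.
Proof.
  intros Ha Hx.
  assert (H := weighted_series_decreasing _ a 0 x _ _ mild_growth_dg Ha
    (conj (Rle_refl 0) (proj1 Hx))
    (proj2 Hx) (is_series_dg a 0 Ha) (is_series_dg a x Ha)). lra.
Qed.

Lemma F_fun_decreasing (alpha a x y : R) : 0 <= alpha < 1 -> 0 < a ->
  0 <= x < y -> y <= 1 -> F_fun alpha a y < F_fun alpha a x.
Proof.
  intros Hal Ha Hx Hy.
  exact (weighted_series_decreasing _ a x y _ _ (mild_growth_F alpha Hal) Ha Hx Hy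
    (is_series_F alpha a x Ha) (is_series_F alpha a y Ha)).
Qed.

Lemma F_fun_param (alpha a b : R) : 0 <= alpha < 1 -> 0 < a < b ->
  0 < F_fun alpha b 1 - F_fun alpha a 1 <= (2 - alpha) / 2 * (/ a - / b).
Proof.
  intros Hal Hab.
  assert (H := weighted_series_increasing_param _ a b _ _ (mild_growth_F alpha Hal) Hab
    (is_series_F alpha a 1 ltac:(lra)) (is_series_F alpha b 1 ltac:(lra))).
  simpl in H.
  replace ((2 - alpha) / 2) with ((1 + 1) * (1 + 1 - alpha) / 4) by field. exact H.
Qed.

Lemma F_fun_bounds (alpha a : R) (N : nat) : 0 <= alpha < 1 -> 0 < a ->
  let t n := INR (S (S n)) * (INR (S (S n)) - alpha) * bcoef a (S n) in
  1 - alpha - sum_f_R0 (tg_alt t) (2 * N) <= F_fun alpha a 1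
    <= 1 - alpha - sum_f_R0 (tg_alt t) (S (2 * N)).
Proof.
  intros Hal Ha t.
  assert (H := weighted_series_tail _ a 1 _ (is_series_F alpha a 1 Ha)). cbv beta in H.
  apply (is_series_ext _ (fun n => (-1) ^ n * t n)) in H.
  2:{ intros n. rewrite pow1. unfold t.
      match goal with |- ?u = ?v => change (@eq R u v) end. ring. }
  apply (alternating_series_bounds t _ N) in H.
  - change (INR 1) with 1 in H. lra.
  - intros n. assert (H1 := mild_growth_ratio _ a n (mild_growth_F alpha Hal) Ha). cbv beta in H1.
    assert (H2 : 0 < t n).
    { apply Rmult_lt_0_compat; [apply (mild_growth_F alpha Hal)|apply bcoef_pos, Ha]. }
    unfold t in *. lra.
Qed.

(** Two tail terms suffice: they give the upper bound [- (5 + 17 alpha) / 42]. By monotonicity the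
    root then exceeds [3/4], the range in which univalence and the bound on [W] are available. *)
Lemma F_fun_neg_threequarters (alpha : R) : 0 <= alpha < 1 -> F_fun alpha (3 / 4) 1 < 0.
Proof.
  intros Hal. assert (H := F_fun_bounds alpha (3 / 4) 0 Hal ltac:(lra)).
  cbv zeta in H. destruct H as [_ H]. eapply Rle_lt_trans; [exact H|].
  unfold tg_alt. simpl. lra.
Qed.

Lemma F_fun_root (alpha : R) : 0 <= alpha < 1 ->
  exists a0, 3 / 4 < a0 /\ F_fun alpha a0 1 = 0.
Proof.
  intros Hal.
  (* [IVT] asks for continuity on the whole line; clamping the parameter at [1/2] makes the function
     Lipschitz everywhere and changes nothing beyond [3/4]. The constant 4 comes from
     [(2 - alpha) / 2 <= 1] and [1 / (a b) <= 4]. *)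
  set (f := fun t => F_fun alpha (Rmax t (1 / 2)) 1).
  assert (HL : forall s t, s < t -> Rabs (f t - f s) <= 4 * (t - s)).
  { assert (Hm : forall s t, s < t -> 0 <= f t - f s <= 4 * (t - s)).
    { intros s t Hst. unfold f. unfold Rmax.
      destruct (Rle_dec t (1 / 2)), (Rle_dec s (1 / 2)); try lra;
      match goal with |- 0 <= F_fun _ ?b 1 - F_fun _ ?a 1 <= _ =>
        destruct (Req_dec a b) as [E|E]; [rewrite E; lra|];
        destruct (F_fun_param alpha a b Hal ltac:(lra)) as [H1 H2];
        split; [lra|]; eapply Rle_trans; [exact H2|];
        replace (/ a - / b) with ((b - a) / (a * b)) by (field; lra);
        assert (E1 : / (a * b) <= 4)
          by (replace 4 with (/ (1 / 4)) by field; apply Rinv_le_contravar; nra);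
        assert (E2 : 0 < / (a * b)) by (apply Rinv_0_lt_compat; nra);
        assert (E3 : (b - a) / (a * b) <= 4 * (b - a)) by (unfold Rdiv; nra);
        assert (E4 : 0 <= (b - a) / (a * b)) by (unfold Rdiv; apply Rmult_le_pos; lra);
        nra
      end. }
    intros s t Hst. rewrite Rabs_pos_eq; apply Hm, Hst. }
  assert (Hc : continuity f).
  { intros t eps Heps. exists (eps / 4). split; [lra|].
    intros s [_ Hs]. simpl in *. unfold R_dist in *.
    destruct (Rtotal_order s t) as [H|[->|H]].
    - rewrite Rabs_minus_sym in *. rewrite Rabs_pos_eq in Hs by lra.
      specialize (HL s t H). lra.
    - unfold Rminus. rewrite Rplus_opp_r, Rabs_R0. lra.
    - rewrite Rabs_pos_eq in Hs by lra. specialize (HL t s H). lra. }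
  (* At this parameter the first tail term is exactly half of [1 - alpha], so [F] is at least
     [(1 - alpha) / 2]. *)
  set (M := (2 - alpha) / (1 - alpha)).
  assert (HM : 1 < M).
  { unfold M. apply Rmult_lt_reg_r with (1 - alpha); [lra|].
    unfold Rdiv; rewrite Rmult_assoc, Rinv_l; lra. }
  destruct (IVT f (3 / 4) M Hc) as (a0 & H1 & H2).
  - lra.
  - unfold f. rewrite Rmax_left by lra. apply F_fun_neg_threequarters, Hal.
  - unfold f. rewrite Rmax_left by lra.
    assert (H := F_fun_bounds alpha M 0 Hal ltac:(lra)).
    cbv zeta in H. destruct H as [H _]. eapply Rlt_le_trans; [|exact H].
    unfold tg_alt. simpl.
    replace (1 - alpha - 1 * ((1 + 1) * (1 + 1 - alpha) * (1 / (4 * 1 * (M + 0)))))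
      with ((1 - alpha) / 2) by (unfold M; field; lra). lra.
  - exists a0. unfold f in H2. rewrite Rmax_left in H2 by lra. split; [|exact H2].
    destruct (Req_dec a0 (3 / 4)) as [E|E]; [|lra].
    generalize (F_fun_neg_threequarters alpha Hal). rewrite <- E. lra.
Qed.

Lemma F_fun_sign (alpha a0 a : R) : 0 <= alpha < 1 -> 0 < a0 -> F_fun alpha a0 1 = 0 ->
  0 < a -> (0 <= F_fun alpha a 1 <-> a0 <= a) /\ (F_fun alpha a 1 = 0 -> a = a0).
Proof.
  intros Hal Ha0 H0 Ha.
  destruct (Rtotal_order a a0) as [H|[->|H]].
  - generalize (F_fun_param alpha a a0 Hal (conj Ha H)). lra.
  - lra.
  - generalize (F_fun_param alpha a0 a Hal (conj Ha0 H)). lra.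
Qed.

(* Partial sums of the alternating series, through degree 4 and degree 5. *)
Lemma F_fun_numeric : F_fun 0 0.8561 1 < 0 < F_fun 0 0.8562 1.
Proof.
  split.
  - assert (H := F_fun_bounds 0 0.8561 1 ltac:(lra) ltac:(lra)).
    cbv zeta in H. destruct H as [_ H]. eapply Rle_lt_trans; [exact H|].
    unfold tg_alt. simpl. lra.
  - assert (H := F_fun_bounds 0 0.8562 2 ltac:(lra) ltac:(lra)).
    cbv zeta in H. destruct H as [H _]. eapply Rlt_le_trans; [|exact H].
    unfold tg_alt. simpl. lra.
Qed.

(** * Reduction of the Bessel functions to power series *)

Lemma Gamma_bcoef (a : R) (n : nat) : 0 < a ->
  INR (fact n) * Gamma (INR n + a) * (4 ^ n * bcoef a n) = Gamma a.
Proof.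
  intros Ha. induction n as [|n IH].
  - simpl. rewrite Rplus_0_l. ring.
  - assert (Hn := pos_INR n).
    rewrite <- IH, bcoef_S, fact_simpl, mult_INR.
    replace (INR (S n) + a) with (INR n + a + 1) by (rewrite S_INR; ring).
    rewrite Gamma_succ by lra. simpl pow.
    assert (0 < INR (S n)) by (apply lt_0_INR; lia).
    set (p := INR (S n)) in *. field. split; lra.
Qed.

(** The factor [4 ^ n] is cancelled later by the powers of [1/2] in [(z / 2) ^ (2 n + nu)]. *)
Lemma besselJ_coef (nu : R) (n : nat) : -1 < nu ->
  (-1) ^ n / (INR (fact n) * Gamma (INR n + nu + 1))
  = / Gamma (nu + 1) * (4 ^ n * phi (nu + 1) n).
Proof.
  intros Hnu. rewrite <- (Gamma_bcoef (nu + 1) n) by lra.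
  replace (INR n + nu + 1) with (INR n + (nu + 1)) by ring.
  assert (Hn := pos_INR n).
  assert (0 < Gamma (INR n + (nu + 1))) by (apply Gamma_pos; lra).
  assert (0 < INR (fact n)) by apply INR_fact_lt_0.
  assert (0 < 4 ^ n) by (apply pow_lt; lra).
  assert (0 < bcoef (nu + 1) n) by (apply bcoef_pos; lra).
  unfold phi. field. repeat split; lra.
Qed.

(** * Principal powers through the complex exponential *)

Lemma Cexp_plus (u v : C) : Cexp (u + v)%C = (Cexp u * Cexp v)%C.
Proof.
  destruct u as [x y], v as [x' y']. unfold Cexp, Cplus, Cmult; simpl.
  rewrite exp_plus, cos_plus, sin_plus. f_equal; ring.
Qed.

Lemma Cexp_RtoC (x : R) : Cexp (RtoC x) = RtoC (exp x).
Proof.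
  unfold Cexp, RtoC; simpl. rewrite cos_0, sin_0. f_equal; ring.
Qed.

Lemma Cexp_INR (n : nat) (u : C) : Cexp (RtoC (INR n) * u)%C = (Cexp u ^ n)%C.
Proof.
  induction n as [|n IH].
  - simpl. rewrite Cmult_0_l, Cexp_RtoC, exp_0. reflexivity.
  - rewrite S_INR, RtoC_plus. simpl Cpow. rewrite <- IH, <- Cexp_plus. f_equal. ring.
Qed.

Lemma Cmod_Cexp (u : C) : Cmod (Cexp u) = exp (Re u).
Proof.
  unfold Cmod, Cexp; simpl.
  replace (_ + _) with (exp (Re u) * exp (Re u) * (Rsqr (sin (Im u)) + Rsqr (cos (Im u))))
    by (unfold Rsqr; ring).
  rewrite sin2_cos2, Rmult_1_r. apply sqrt_square, Rlt_le, exp_pos.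
Qed.

Lemma Cexp_ne_0 (u : C) : Cexp u <> 0.
Proof.
  intros E. assert (H := Cmod_Cexp u). rewrite E, Cmod_0 in H.
  generalize (exp_pos (Re u)). lra.
Qed.

Lemma Re_div_Cmod_bounds (z : C) : z <> 0 -> -1 <= Re z / Cmod z <= 1.
Proof.
  intros Hz. apply Cmod_gt_0 in Hz.
  assert (H := re_le_Cmod z). apply Rabs_le_between in H.
  split; apply Rmult_le_reg_r with (Cmod z); try exact Hz;
  unfold Rdiv; rewrite ?Rmult_assoc, ?Rinv_l by lra; lra.
Qed.

Lemma Carg_bounds (z : C) : - PI <= Carg z <= PI.
Proof.
  unfold Carg. assert (H := acos_bound (Re z / Cmod z)).
  destruct (Rle_dec 0 (Im z)); lra.
Qed.

Lemma Cexp_Clog (z : C) : z <> 0 -> Cexp (Clog z) = z.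
Proof.
  intros Hz. assert (Hb := Re_div_Cmod_bounds z Hz). apply Cmod_gt_0 in Hz.
  unfold Cexp, Clog. simpl. rewrite exp_ln by exact Hz.
  assert (Hc : cos (Carg z) = Re z / Cmod z).
  { unfold Carg. destruct (Rle_dec 0 (Im z)); rewrite ?cos_neg; apply cos_acos; exact Hb. }
  (* The sine of an arccosine is nonnegative, so only the modulus of [Im z] appears; the two
     branches of [Carg] restore the sign. *)
  assert (Hs : sin (acos (Re z / Cmod z)) = Rabs (Im z) / Cmod z).
  { rewrite sin_acos by exact Hb.
    replace (1 - (Re z / Cmod z)²) with ((Im z / Cmod z)²).
    - rewrite sqrt_Rsqr_abs, Rabs_div by lra. rewrite (Rabs_pos_eq (Cmod z)); lra.
    - assert (E := Cmod2_alt z). unfold Rsqr.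
      replace (Im z / Cmod z * (Im z / Cmod z)) with (Im z ^ 2 / Cmod z ^ 2) by (field; lra).
      replace (Im z ^ 2) with (Cmod z ^ 2 - Re z ^ 2) by lra. field. lra. }
  rewrite Hc. unfold Carg. destruct z as [x y]; unfold Re, Im in *; simpl in *.
  destruct (Rle_dec 0 y); rewrite ?sin_neg, Hs.
  - rewrite Rabs_pos_eq by assumption. f_equal; field; lra.
  - rewrite Rabs_left by lra. f_equal; field; lra.
Qed.

Lemma Clog_Cexp (u : C) : - PI < Im u <= PI -> Clog (Cexp u) = u.
Proof.
  intros Hu. unfold Clog. rewrite Cmod_Cexp, ln_exp.
  assert (He := exp_pos (Re u)).
  assert (HC : Carg (Cexp u) = Im u).
  { unfold Carg. rewrite Cmod_Cexp. unfold Cexp. simpl Re. simpl Im.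
    replace (exp (Re u) * cos (Im u) / exp (Re u)) with (cos (Im u)) by (field; lra).
    destruct (Rle_dec 0 (exp (Re u) * sin (Im u))) as [H|H].
    - destruct (Rle_or_lt 0 (Im u)); [apply acos_cos; lra|].
      exfalso. assert (0 < sin (- Im u)) by (apply sin_gt_0; lra).
      rewrite sin_neg in *. nra.
    - destruct (Rle_or_lt 0 (Im u)).
      + exfalso; apply H. apply Rmult_le_pos; [lra|apply sin_ge_0; lra].
      + rewrite <- cos_neg, acos_cos by lra. ring. }
  rewrite HC. destruct u; reflexivity.
Qed.

Lemma Cpower_ne_0 (z : C) (b : R) : z <> 0 -> Cpower z b = Cexp (RtoC b * Clog z)%C.
Proof. intros Hz. unfold Cpower. destruct (Ceq_dec z 0); [contradiction|reflexivity]. Qed.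

(** In the strip [Clog] inverts [Cexp], so each power in the series is a single exponential of
    [(2 n + nu) (u - ln 2)]. Its [nu] part is common to all terms, and the rest is the n-th power of
    [exp (2 u) / 4]. *)
Lemma besselJ_Cexp (nu : R) (u : C) : -1 < nu -> - PI < Im u <= PI ->
  besselJ nu (Cexp u) =
  (Cexp (RtoC nu * (u - RtoC (ln 2))) * RtoC (/ Gamma (nu + 1))
   * CPSeries (phi (nu + 1)) (Cexp (RtoC 2 * u)))%C.
Proof.
  intros Hnu Hu. apply Cseries_unique.
  assert (H := is_Cseries_scal
    (Cexp (RtoC nu * (u - RtoC (ln 2))) * RtoC (/ Gamma (nu + 1)))%C _ _
    (CPSeries_correct (phi (nu + 1)) (Cexp (RtoC 2 * u))
       (entire_phi (nu + 1) _ ltac:(lra)))).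
  revert H. apply is_Cseries_ext. intros n. cbv beta.
  rewrite besselJ_coef by exact Hnu.
  assert (E2 : Cexp (RtoC (ln 2)) = RtoC 2) by (rewrite Cexp_RtoC, exp_ln by lra; reflexivity).
  replace (Cexp u / RtoC 2)%C with (Cexp (u - RtoC (ln 2))).
  2:{ replace (Cexp u) with (Cexp (u - RtoC (ln 2)) * Cexp (RtoC (ln 2)))%C
        by (rewrite <- Cexp_plus; f_equal; ring).
      rewrite E2. field. }
  rewrite Cpower_ne_0 by apply Cexp_ne_0.
  rewrite Clog_Cexp.
  2:{ destruct u as [x y]; simpl in *. lra. }
  replace (RtoC (2 * INR n + nu) * (u - RtoC (ln 2)))%C with
    (RtoC nu * (u - RtoC (ln 2)) + RtoC (INR n) * (RtoC 2 * u)
     + RtoC (INR n) * RtoC (- (2 * ln 2)))%C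
    by (rewrite RtoC_plus, RtoC_opp, !RtoC_mult; ring).
  rewrite !Cexp_plus, !Cexp_INR, Cexp_RtoC.
  replace (exp (- (2 * ln 2))) with (/ 4).
  2:{ rewrite exp_Ropp. f_equal. replace (2 * ln 2) with (ln 2 + ln 2) by ring.
      rewrite exp_plus, exp_ln by lra. ring. }
  rewrite !RtoC_mult, RtoC_pow.
  replace (RtoC (/ 4) ^ n)%C with (RtoC ((/ 4) ^ n)) by apply RtoC_pow.
  replace (RtoC 4 ^ n)%C with (RtoC (4 ^ n)) by apply RtoC_pow.
  replace (RtoC (4 ^ n) * RtoC (phi (nu + 1) n))%C with
     (RtoC (phi (nu + 1) n) * RtoC (4 ^ n))%C by ring.
  assert (E4 : (RtoC (4 ^ n) * RtoC ((/ 4) ^ n) = RtoC 1)%C).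
  { rewrite <- RtoC_mult, <- Rpow_mult_distr, Rinv_r, pow1 by lra. reflexivity. }
  transitivity (RtoC (/ Gamma (nu + 1)) * RtoC (phi (nu + 1) n)
     * (Cexp (RtoC nu * (u - RtoC (ln 2))) * Cexp (RtoC 2 * u) ^ n)
     * (RtoC (4 ^ n) * RtoC ((/ 4) ^ n)))%C; [rewrite E4|]; ring.
Qed.

Lemma bessel_h_series (nu : R) (z : C) : -1 < nu ->
  bessel_h nu z = CPSeries (h_coef (nu + 1)) z.
Proof.
  intros Hnu. rewrite h_series by lra. unfold bessel_h, Csqrt.
  destruct (Ceq_dec z 0) as [->|Hz].
  - rewrite Cmult_0_l.
    assert (HP0 : forall b, b <> 0 -> Cpower 0 b = 0).
    { intros b Hb. unfold Cpower. destruct (Ceq_dec 0 0) as [_|H]; [|contradiction H; reflexivity].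
      destruct (Req_EM_T b 0); [contradiction|reflexivity]. }
    rewrite (HP0 (1 / 2)) by lra.
    (* For [nu = 2] the outer power is [0 ^ 0 = 1], and the value 0 comes from the Bessel factor. *)
    destruct (Req_dec (1 - nu / 2) 0) as [E|E].
    + replace (besselJ nu 0) with (RtoC 0); [ring|].
      symmetry. apply Cseries_unique.
      apply (is_Cseries_ext (fun _ => RtoC 0)).
      * intros n. replace (0 / RtoC 2)%C with (RtoC 0).
        -- rewrite HP0; [ring|]. generalize (pos_INR n). lra.
        -- field.
      * split; exact is_series_zero.
    + rewrite HP0 by exact E. ring.
  - rewrite !Cpower_ne_0 by exact Hz.
    set (L := Clog z).
    assert (HL : - PI <= Im L <= PI) by apply Carg_bounds.
    assert (HPI := PI_RGT_0).
    rewrite besselJ_Cexp; [|exact Hnu|].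
    (* Halving the logarithm puts its imaginary part in [[- PI / 2, PI / 2]], inside the strip even
       when [z] is a negative real. *)
    2:{ destruct L as [x y]; simpl in *. lra. }
    replace (RtoC 2 * (RtoC (1 / 2) * L))%C with L.
    2:{ rewrite Cmult_assoc, <- RtoC_mult. replace (2 * (1 / 2)) with 1 by field. ring. }
    assert (HG := Gamma_pos (nu + 1) ltac:(lra)).
    replace (Cexp L) with z by (symmetry; apply Cexp_Clog, Hz).
    rewrite Cmult_assoc. f_equal.
    (* The three exponents [nu ln 2], [(1 - nu/2) L] and [nu (L/2 - ln 2)] add up to [L]. *)
    transitivity (RtoC (Gamma (nu + 1)) * RtoC (/ Gamma (nu + 1)) *
      (Cexp (RtoC (nu * ln 2)) * Cexp (RtoC (1 - nu / 2) * L)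
       * Cexp (RtoC nu * (RtoC (1 / 2) * L - RtoC (ln 2)))))%C.
    { rewrite Cexp_RtoC, RtoC_mult. unfold Rpower. ring. }
    rewrite <- RtoC_mult, Rinv_r, <- !Cexp_plus by lra.
    rewrite Cmult_1_l. rewrite <- (Cexp_Clog z Hz). fold L. f_equal.
    rewrite RtoC_mult. replace (1 - nu / 2) with (1 - nu * (1 / 2)) by field.
    rewrite RtoC_minus, RtoC_mult. ring.
Qed.

(** * Bessel values at 1 and the equation of the theorem *)

Lemma besselJ_one (nu : R) : -1 < nu ->
  besselJ nu (RtoC 1) =
  RtoC (exp (- (nu * ln 2)) / Gamma (nu + 1) * PSeries (phi (nu + 1)) 1).
Proof.
  intros Hnu. replace (RtoC 1) with (Cexp (RtoC 0)) at 1
    by (rewrite Cexp_RtoC, exp_0; reflexivity).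
  assert (HPI := PI_RGT_0).
  rewrite besselJ_Cexp by (simpl; lra).
  replace (RtoC 2 * RtoC 0)%C with (RtoC 0) by ring.
  replace (RtoC nu * (RtoC 0 - RtoC (ln 2)))%C with (RtoC (- (nu * ln 2)))
    by (rewrite RtoC_opp, RtoC_mult; ring).
  rewrite !Cexp_RtoC, exp_0, CPSeries_real, <- !RtoC_mult. reflexivity.
Qed.

(** The hypergeometric derivative rule [phi_a' = - phi_(a+1) / (4a)], through which [J_(nu+1)(1)]
    becomes a multiple of [phi'(1)]. The induction uses the recursion [phi_S] at both parameters. *)
Lemma dphi_shift (a : R) (n : nat) : 0 < a ->
  PS_derive (phi a) n = - / (4 * a) * phi (a + 1) n.
Proof.
  intros Ha. unfold PS_derive.
  induction n as [|n IH].
  - unfold phi. simpl. field. lra.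
  - assert (E1 := phi_S a (S n) Ha). assert (E2 := phi_S (a + 1) n ltac:(lra)).
    assert (Hn := pos_INR n). rewrite (S_INR n) in E1, E2.
    assert (Hx : 0 < INR n + 1) by lra.
    rewrite S_INR in IH.
    apply Rmult_eq_reg_l with ((a + (INR n + 1)) * (INR n + 1)).
    2:{ apply Rmult_integral_contrapositive_currified; lra. }
    transitivity ((INR n + 1) * ((a + (INR n + 1)) * (INR (S (S n)) * phi a (S (S n))))); [ring|].
    rewrite E1.
    transitivity (- ((INR n + 1) * phi a (S n)) / 4); [field|]. rewrite IH.
    transitivity (- / (4 * a) * ((a + 1 + INR n) * ((INR n + 1) * phi (a + 1) (S n)))); [|ring].
    rewrite E2. field. lra.
Qed.

Lemma besselJ_succ_one (nu : R) : -1 < nu ->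
  besselJ (nu + 1) (RtoC 1) =
  RtoC (- 2 * (exp (- (nu * ln 2)) / Gamma (nu + 1)) * PSeries (PS_derive (phi (nu + 1))) 1).
Proof.
  intros Hnu. rewrite besselJ_one by lra. f_equal.
  rewrite (PSeries_ext (PS_derive (phi (nu + 1)))
     (PS_scal (- / (4 * (nu + 1))) (phi (nu + 1 + 1)))).
  2:{ intros n. apply dphi_shift; lra. }
  rewrite PSeries_scal, Gamma_succ by lra.
  assert (HG := Gamma_pos (nu + 1) ltac:(lra)).
  replace (- ((nu + 1) * ln 2)) with (- (nu * ln 2) + - ln 2) by ring.
  rewrite exp_plus, (exp_Ropp (ln 2)), exp_ln by lra. field. lra.
Qed.

Lemma F_fun_one (alpha a : R) : 0 < a ->
  F_fun alpha a 1 =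
  (3 - a - alpha) * PSeries (PS_derive (phi a)) 1 + (3 / 4 - alpha) * PSeries (phi a) 1.
Proof.
  intros Ha.
  assert (Eg : g_fun a 1 = PSeries (phi a) 1 + PSeries (PS_derive (phi a)) 1).
  { apply RtoC_inj. assert (E := g_series a (RtoC 1) Ha).
    rewrite !CPSeries_real in E. unfold g_fun. rewrite E, RtoC_plus. ring. }
  assert (Ed : PSeries (dg_coef a) 1 =
     (2 - a) * PSeries (PS_derive (phi a)) 1 - / 4 * PSeries (phi a) 1).
  { apply RtoC_inj. assert (E := dg_series a (RtoC 1) Ha).
    rewrite !CPSeries_real in E. rewrite E, <- !RtoC_mult, <- RtoC_minus. reflexivity. }
  unfold F_fun. rewrite Eg, Ed. field.
Qed.

(** With [J_nu(1) = k phi(1)], [J_(nu+1)(1) = - 2 k phi'(1)] and [k > 0], the left side minus the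
    right side equals [4 k F(1)]. *)
Lemma bessel_equation_iff (alpha nu : R) : -1 < nu ->
  (RtoC (2 * nu + 2 * alpha - 4) * besselJ (nu + 1) (RtoC 1)
   = RtoC (4 * alpha - 3) * besselJ nu (RtoC 1))%C
  <-> F_fun alpha (nu + 1) 1 = 0.
Proof.
  intros Hnu. rewrite besselJ_succ_one, besselJ_one, F_fun_one by lra.
  assert (HG := Gamma_pos (nu + 1) ltac:(lra)).
  assert (Hk : 0 < exp (- (nu * ln 2)) / Gamma (nu + 1))
    by (apply Rdiv_lt_0_compat; [apply exp_pos|exact HG]).
  set (k := exp (- (nu * ln 2)) / Gamma (nu + 1)) in *.
  set (p := PSeries (phi (nu + 1)) 1). set (dp := PSeries (PS_derive (phi (nu + 1))) 1).
  rewrite <- !RtoC_mult. split; intros H.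
  - apply RtoC_inj in H. apply Rmult_eq_reg_l with (4 * k); [|lra].
    rewrite Rmult_0_r. lra.
  - f_equal. assert (E := Rmult_eq_compat_l (4 * k) _ _ H). lra.
Qed.

(** * Convexity *)

Lemma is_derive_bessel_h (nu : R) (z : C) : -1 < nu ->
  @is_derive C_AbsRing C_NormedModule (bessel_h nu) z (CPSeries (g_coef (nu + 1)) z).
Proof.
  intros Hnu. apply (is_derive_ext (CPSeries (h_coef (nu + 1)))).
  - intros t. symmetry. apply bessel_h_series, Hnu.
  - apply is_derive_CPSeries, entire_h. lra.
Qed.

Lemma C_derive_bessel_h (nu : R) (z : C) : -1 < nu ->
  C_derive (bessel_h nu) z = CPSeries (g_coef (nu + 1)) z.
Proof. intros Hnu. apply is_C_derive_unique, is_derive_bessel_h, Hnu. Qed.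

Lemma C_derive2_bessel_h (nu : R) (z : C) : -1 < nu ->
  C_derive (C_derive (bessel_h nu)) z = CPSeries (dg_coef (nu + 1)) z.
Proof.
  intros Hnu. apply is_C_derive_unique.
  apply (is_derive_ext (CPSeries (g_coef (nu + 1)))).
  - intros t. symmetry. apply C_derive_bessel_h, Hnu.
  - apply is_derive_CPSeries, entire_g. lra.
Qed.

(** * Nonvanishing derivative and univalence for [a > 3/4] *)

Lemma g_tail_term_le (a : R) (n : nat) : 3 / 4 < a ->
  INR (S (S n)) * bcoef a (S n) <= 2 / 3 * (/ 4) ^ n.
Proof.
  intros Ha. induction n as [|n IH].
  - simpl. assert (/ a <= / (3 / 4)) by (apply Rinv_le_contravar; lra).
    replace ((1 + 1) * (1 / (4 * 1 * (a + 0)))) with (/ 2 * / a) by (field; lra). lra.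
  - rewrite (bcoef_S a (S n)). simpl pow.
    assert (Hb := bcoef_pos a (S n) ltac:(lra)). assert (Hn := pos_INR n).
    rewrite !S_INR in *. set (x := INR n) in *. set (b := bcoef a (S n)) in *.
    apply Rle_trans with (/ 4 * ((x + 1 + 1) * b)); [|lra].
    apply Rmult_le_reg_r with (4 * (x + 1 + 1) * (a + (x + 1))).
    { apply Rmult_lt_0_compat; nra. }
    replace ((x + 1 + 1 + 1) * (b / (4 * (x + 1 + 1) * (a + (x + 1)))) *
      (4 * (x + 1 + 1) * (a + (x + 1)))) with ((x + 1 + 1 + 1) * b) by (field; nra).
    replace (/ 4 * ((x + 1 + 1) * b) * (4 * (x + 1 + 1) * (a + (x + 1))))
      with ((x + 1 + 1) * (x + 1 + 1) * (a + (x + 1)) * b) by field.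
    apply Rmult_le_compat_r; [lra|]. nra.
Qed.

(** The geometric majorant sums to [(2/3) / (1 - 1/4) = 8/9 < 1]. It serves twice: with [K = 1] for
    [g - 1], and with [K = Cmod (z - y)] for injectivity. *)
Lemma g_tail_Cmod_le (a K : R) (c : nat -> C) (s : C) : 3 / 4 < a -> 0 <= K ->
  is_Cseries c s -> (forall n, Cmod (c n) <= INR (S (S n)) * bcoef a (S n) * K) ->
  Cmod s <= 8 / 9 * K.
Proof.
  intros Ha HK Hs Hc.
  assert (Hg := is_series_scal (2 / 3 * K) _ _
    (is_series_geom (/ 4) ltac:(rewrite Rabs_pos_eq; lra))).
  replace (8 / 9 * K) with (scal (2 / 3 * K) (/ (1 - / 4)))
    by (unfold scal; simpl; unfold mult; simpl; field).
  apply (is_Cseries_Cmod_le _ _ _ _) with (2 := Hs) (3 := Hg).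
  intros n. eapply Rle_trans; [apply Hc|].
  assert (H := g_tail_term_le a n Ha).
  apply (Rmult_le_compat_r K) in H; [|exact HK].
  change (INR (S (S n)) * bcoef a (S n) * K <= 2 / 3 * K * (/ 4) ^ n). lra.
Qed.

Lemma g_close_to_one (a : R) (z : C) : 3 / 4 < a -> Cmod z <= 1 ->
  Cmod (CPSeries (g_coef a) z - 1)%C <= 8 / 9.
Proof.
  intros Ha Hz.
  assert (H := is_Cseries_incr_1 _ _
    (CPSeries_correct (g_coef a) z (entire_g a _ ltac:(lra)))).
  replace (CPSeries (g_coef a) z - 1)%C with
    (CPSeries (g_coef a) z - RtoC (g_coef a 0) * z ^ 0)%C.
  2:{ rewrite g_coef_E. unfold phi. simpl. rewrite !Rmult_1_r. ring. }
  rewrite <- (Rmult_1_r (8 / 9)).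
  apply (g_tail_Cmod_le a 1 _ _ Ha ltac:(lra) H).
  intros n. rewrite Cmod_pseries_term, g_coef_E, !Rabs_mult, Rabs_phi by lra.
  rewrite (Rabs_pos_eq (INR _)) by apply pos_INR.
  apply Rmult_le_compat_l.
  - apply Rmult_le_pos; [apply pos_INR|apply Rlt_le, bcoef_pos; lra].
  - rewrite Rabs_pos_eq by (apply pow_le, Cmod_ge_0).
    rewrite <- (pow1 (S n)). apply pow_incr. split; [apply Cmod_ge_0|exact Hz].
Qed.

Lemma g_series_ne_0 (a : R) (z : C) : 3 / 4 < a -> Cmod z <= 1 ->
  CPSeries (g_coef a) z <> 0.
Proof.
  intros Ha Hz E. assert (H := g_close_to_one a z Ha Hz). rewrite E in H.
  replace (0 - 1)%C with (- (1))%C in H by ring. rewrite Cmod_opp, Cmod_1 in H. lra.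
Qed.

Lemma g_fun_pos (a x : R) : 3 / 4 < a -> 0 <= x <= 1 -> 0 < g_fun a x.
Proof.
  intros Ha Hx.
  assert (H := g_close_to_one a (RtoC x) Ha ltac:(rewrite Cmod_R, Rabs_pos_eq; lra)).
  rewrite CPSeries_real, <- RtoC_minus, Cmod_R in H.
  apply Rabs_le_between in H. unfold g_fun. lra.
Qed.

Lemma Cpow_sub_Cmod_le (z y : C) (n : nat) : Cmod z <= 1 -> Cmod y <= 1 ->
  Cmod (z ^ n - y ^ n)%C <= INR n * Cmod (z - y).
Proof.
  intros Hz Hy. induction n as [|n IH].
  - simpl. replace (1 - 1)%C with (RtoC 0) by ring. rewrite Cmod_0. lra.
  - replace (z ^ S n - y ^ S n)%C with (z * (z ^ n - y ^ n) + y ^ n * (z - y))%C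
      by (simpl; ring).
    eapply Rle_trans; [apply Cmod_triangle|]. rewrite !Cmod_mult, Cmod_pow, S_INR.
    assert (Cmod y ^ n <= 1).
    { rewrite <- (pow1 n). apply pow_incr. split; [apply Cmod_ge_0|exact Hy]. }
    assert (0 <= Cmod (z - y)) by apply Cmod_ge_0.
    assert (0 <= Cmod (z ^ n - y ^ n)) by apply Cmod_ge_0.
    assert (0 <= Cmod z) by apply Cmod_ge_0.
    nra.
Qed.

(** The map [h(x) - x] is Lipschitz with constant [8/9] on the closed disk, because differences of
    m-th powers there are at most [m] times [Cmod (z - y)]. If [h z = h y], then
    [Cmod (z - y) <= 8/9 * Cmod (z - y)]. *)
Lemma h_series_injective (a : R) (z y : C) : 3 / 4 < a -> Cmod z <= 1 -> Cmod y <= 1 ->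
  CPSeries (h_coef a) z = CPSeries (h_coef a) y -> z = y.
Proof.
  intros Ha Hz Hy E.
  assert (Hser : forall x, is_Cseries (fun n => RtoC (phi a (S n)) * x ^ S (S n))%C
      (CPSeries (h_coef a) x - x)%C).
  { intros x. assert (H := is_Cseries_incr_1 _ _ (is_Cseries_incr_1 _ _
      (CPSeries_correct (h_coef a) x (entire_h a _ ltac:(lra))))). cbv beta in H.
    replace (CPSeries (h_coef a) x - x)%C with
      (CPSeries (h_coef a) x - RtoC (h_coef a 0) * x ^ 0 - RtoC (h_coef a 1) * x ^ 1)%C.
    - exact H.
    - unfold h_coef, phi; simpl. change (zero : R) with 0. rewrite Rmult_1_r. ring. }
  assert (H := is_Cseries_minus _ _ _ _ (Hser z) (Hser y)). rewrite E in H.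
  apply (g_tail_Cmod_le a (Cmod (z - y)) _ _ Ha (Cmod_ge_0 _)) in H.
  - replace (CPSeries (h_coef a) y - z - (CPSeries (h_coef a) y - y))%C with (- (z - y))%C
      in H by ring.
    rewrite Cmod_opp in H.
    assert (Hd : (z - y)%C = 0).
    { apply Cmod_eq_0. generalize (Cmod_ge_0 (z - y)). lra. }
    replace z with (z - y + y)%C by ring. rewrite Hd. ring.
  - intros n. cbv beta.
    replace (RtoC (phi a (S n)) * z ^ S (S n) - RtoC (phi a (S n)) * y ^ S (S n))%C
      with (RtoC (phi a (S n)) * (z ^ S (S n) - y ^ S (S n)))%C by ring.
    rewrite Cmod_mult, Cmod_R, Rabs_phi by lra.
    rewrite (Rmult_comm (INR _)), Rmult_assoc.
    apply Rmult_le_compat_l; [apply Rlt_le, bcoef_pos; lra|].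
    apply Cpow_sub_Cmod_le; assumption.
Qed.

(** * Sufficiency *)

Lemma convex_of_order_sufficient (alpha nu : R) : 0 <= alpha < 1 -> 3 / 4 < nu + 1 ->
  0 <= F_fun alpha (nu + 1) 1 -> convex_of_order alpha (bessel_h nu).
Proof.
  intros Hal Ha HF. set (a := nu + 1) in *. assert (Hnu : -1 < nu) by (unfold a in Ha; lra).
  assert (H0 : Cmod 0 <= 1) by (rewrite Cmod_0; lra).
  split; [|split; [|split]].
  - rewrite bessel_h_series, h_series by (unfold a in Ha; lra). ring.
  - rewrite C_derive_bessel_h by exact Hnu. fold a.
    rewrite CPSeries_decr_1 by (apply entire_g; lra).
    rewrite g_coef_E. unfold phi. simpl. rewrite !Rmult_1_r. ring.
  - split.
    + intros z _. eexists. apply is_derive_bessel_h, Hnu.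
    + intros z y Hz Hy. rewrite !bessel_h_series by exact Hnu.
      unfold unit_disk in *. apply h_series_injective; lra || exact Ha.
  - intros z Hz. unfold unit_disk in Hz.
    rewrite C_derive2_bessel_h, C_derive_bessel_h by exact Hnu. fold a.
    assert (Hr := Cmod_ge_0 z).
    assert (Hg : 0 < g_fun a (Cmod z)) by (apply g_fun_pos; lra).
    assert (HB := log_derivative_g_Cmod_le a z Ha ltac:(lra)
       (g_series_ne_0 a z Ha ltac:(lra)) ltac:(unfold g_fun in Hg; lra)).
    assert (HFr := F_fun_decreasing alpha a (Cmod z) 1 Hal ltac:(lra) ltac:(lra) ltac:(lra)).
    unfold F_fun at 2 in HFr. fold (g_fun a (Cmod z)) in HB.
    set (q := (z * CPSeries (dg_coef a) z / CPSeries (g_coef a) z)%C) in *.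
    assert (Hq := re_le_Cmod q). apply Rabs_le_between in Hq.
    replace (Re (RtoC 1 + q)%C) with (1 + Re q) by (destruct q; reflexivity).
    set (D := Cmod z * PSeries (dg_coef a) (Cmod z)) in *.
    (* This is [F(r) > 0] divided by [g(r) > 0], where [r = Cmod z]; strictness comes from [r < 1].
       The claim follows from [Re q >= - Cmod q >= D / g(r)]. *)
    assert (HD : - (1 - alpha) < D / g_fun a (Cmod z)).
    { apply Rmult_lt_reg_r with (g_fun a (Cmod z)); [exact Hg|].
      unfold Rdiv; rewrite Rmult_assoc, Rinv_l by lra. lra. }
    lra.
Qed.

(** * Necessity *)

Lemma F_fun_continuous (alpha a x : R) : 0 < a -> continuity_pt (F_fun alpha a) x.
Proof.
  intros Ha.
  apply (continuity_pt_plus (fun x => x * PSeries (dg_coef a) x)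
    (fun x => (1 - alpha) * g_fun a x)).
  - apply (continuity_pt_mult (fun x => x) (PSeries (dg_coef a))).
    + apply derivable_continuous_pt, derivable_pt_id.
    + apply PSeries_continuity, entire_dg, Ha.
  - apply (continuity_pt_mult (fun _ => 1 - alpha) (PSeries (g_coef a))).
    + apply continuity_pt_const. intros ? ?; reflexivity.
    + apply PSeries_continuity, entire_g, Ha.
Qed.

Lemma F_fun_neg_left (alpha a r : R) : 0 < a -> 0 < r -> F_fun alpha a r < 0 ->
  exists x, 0 < x < r /\ F_fun alpha a x < 0.
Proof.
  intros Ha Hr HF.
  destruct (F_fun_continuous alpha a r Ha (- F_fun alpha a r)) as (d & Hd & H); [lra|].
  assert (Hm : 0 < Rmin d r) by (apply Rmin_glb_lt; lra).
  assert (Hm1 := Rmin_l d r). assert (Hm2 := Rmin_r d r).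
  exists (r - Rmin d r / 2). split; [lra|].
  specialize (H (r - Rmin d r / 2)). simpl in H. unfold R_dist in H.
  assert (Hx : Rabs (F_fun alpha a (r - Rmin d r / 2) - F_fun alpha a r) < - F_fun alpha a r).
  { apply H. split; [split; [exact I|lra]|].
    replace (r - Rmin d r / 2 - r) with (- (Rmin d r / 2)) by ring.
    rewrite Rabs_Ropp, Rabs_pos_eq; lra. }
  apply Rabs_def2 in Hx. lra.
Qed.

(* At the first zero of [g] in (0, 1), if any, [F = x g' < 0]. *)
Lemma F_fun_neg_before_zero (alpha a : R) : 0 < a -> F_fun alpha a 1 < 0 ->
  exists x, 0 < x < 1 /\ 0 < g_fun a x /\ F_fun alpha a x < 0.
Proof.
  intros Ha HF.
  destruct (Rlt_or_le 0 (g_fun a 1)) as [Hg|Hg].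
  - destruct (F_fun_neg_left alpha a 1 Ha Rlt_0_1 HF) as (x & Hx & HFx).
    exists x. split; [exact Hx|split; [|exact HFx]].
    generalize (g_fun_decreasing a x 1 Ha ltac:(lra) ltac:(lra)). lra.
  - assert (Hg0 : g_fun a 0 = 1).
    { unfold g_fun. rewrite PSeries_0. rewrite g_coef_E. unfold phi. simpl. ring. }
    assert (Hz : exists r, 0 < r <= 1 /\ g_fun a r = 0).
    { destruct Hg as [Hg|Hg]; [|exists 1; split; [lra|exact Hg]].
      destruct (IVT (fun x => - g_fun a x) 0 1) as (r & Hr & E); try lra.
      - intros x. apply (continuity_pt_opp (PSeries (g_coef a))).
        apply PSeries_continuity, entire_g, Ha.
      - exists r. split; [|lra].
        destruct (Req_dec r 0) as [->|Hr0]; lra. }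
    destruct Hz as (r & Hr & E).
    destruct (F_fun_neg_left alpha a r Ha) as (x & Hx & HFx); [lra| |].
    + unfold F_fun. rewrite E. generalize (dg_neg a r Ha Hr). lra.
    + exists x. split; [lra|split; [|exact HFx]].
      generalize (g_fun_decreasing a x r Ha ltac:(lra) ltac:(lra)). lra.
Qed.

(** The order condition is tested at one real point, where [g > 0]: multiplied by [g] it says
    [F > 0], against the choice of the point. *)
Lemma convex_of_order_necessary (alpha nu : R) : -1 < nu ->
  convex_of_order alpha (bessel_h nu) -> 0 <= F_fun alpha (nu + 1) 1.
Proof.
  intros Hnu (_ & _ & _ & H). set (a := nu + 1). assert (Ha : 0 < a) by (unfold a; lra).
  destruct (Rle_or_lt 0 (F_fun alpha a 1)) as [|HF]; [assumption|exfalso].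
  destruct (F_fun_neg_before_zero alpha a Ha HF) as (x & Hx & Hg & HFx).
  assert (Hd : unit_disk (RtoC x)) by (unfold unit_disk; rewrite Cmod_R, Rabs_pos_eq; lra).
  specialize (H _ Hd).
  rewrite C_derive2_bessel_h, C_derive_bessel_h in H by exact Hnu. fold a in H.
  rewrite !CPSeries_real in H. fold (g_fun a x) in H.
  rewrite <- RtoC_mult, <- RtoC_div, <- RtoC_plus in H by lra. simpl in H.
  unfold F_fun in HFx. set (D := x * PSeries (dg_coef a) x) in *.
  assert (HD : D / g_fun a x * g_fun a x = D) by (field; lra).
  nra.
Qed.

(** * The threshold and its special values *)

Lemma convex_of_order_iff (alpha a0 nu : R) : 0 <= alpha < 1 -> 3 / 4 < a0 ->
  F_fun alpha a0 1 = 0 -> -1 < nu ->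
  (convex_of_order alpha (bessel_h nu) <-> nu >= a0 - 1).
Proof.
  intros Hal Ha0 H0 Hnu.
  destruct (F_fun_sign alpha a0 (nu + 1) Hal ltac:(lra) H0 ltac:(lra)) as [Hs _].
  split; intros H.
  - apply convex_of_order_necessary, Hs in H; lra.
  - apply convex_of_order_sufficient; [exact Hal|lra|]. apply Hs. lra.
Qed.

Lemma bessel_equation_unique (alpha a0 : R) : 0 <= alpha < 1 -> 3 / 4 < a0 ->
  F_fun alpha a0 1 = 0 ->
  unique (fun nu : R => -1 < nu /\
    (RtoC (2 * nu + 2 * alpha - 4) * besselJ (nu + 1) (RtoC 1)
     = RtoC (4 * alpha - 3) * besselJ nu (RtoC 1))%C) (a0 - 1).
Proof.
  intros Hal Ha0 H0. split.
  - split; [lra|]. apply bessel_equation_iff; [lra|].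
    replace (a0 - 1 + 1) with a0 by ring. exact H0.
  - intros nu [Hnu E]. apply bessel_equation_iff in E; [|exact Hnu].
    apply (F_fun_sign alpha a0 (nu + 1) Hal ltac:(lra) H0 ltac:(lra)) in E. lra.
Qed.

Theorem theorem6 :
  (forall alpha : R, 0 <= alpha < 1 ->
     exists nu_alpha : R,
       unique
         (fun nu : R =>
            -1 < nu /\
            (RtoC (2 * nu + 2 * alpha - 4) * besselJ (nu + 1) (RtoC 1)
             = RtoC (4 * alpha - 3) * besselJ nu (RtoC 1))%C)
         nu_alpha /\
       forall nu : R, -1 < nu ->
         (convex_of_order alpha (bessel_h nu) <-> nu >= nu_alpha)) /\
  (exists nu_0 : R,
     unique
       (fun nu : R =>
          -1 < nu /\
          (RtoC (2 * nu - 4) * besselJ (nu + 1) (RtoC 1)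
           + RtoC 3 * besselJ nu (RtoC 1) = RtoC 0)%C)
       nu_0 /\
     -0.1439 < nu_0 < -0.1438 /\
     forall nu : R, -1 < nu ->
       (convex (bessel_h nu) <-> nu >= nu_0)) /\
  (forall nu : R, -1 < nu ->
     (convex_of_order (3 / 4) (bessel_h nu) <-> nu >= 5 / 4)).
Proof.
  split; [|split].
  - intros alpha Hal. destruct (F_fun_root alpha Hal) as (a0 & Ha0 & H0).
    exists (a0 - 1). split; [apply bessel_equation_unique; assumption|].
    intros nu Hnu. apply convex_of_order_iff; assumption.
  - assert (Hal : 0 <= 0 < 1) by lra.
    destruct (F_fun_root 0 Hal) as (a0 & Ha0 & H0).
    exists (a0 - 1). split; [|split].
    + assert (Heq : forall nu : R,
        (RtoC (2 * nu - 4) * besselJ (nu + 1) (RtoC 1)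
           + RtoC 3 * besselJ nu (RtoC 1) = RtoC 0)%C <->
        (RtoC (2 * nu + 2 * 0 - 4) * besselJ (nu + 1) (RtoC 1)
           = RtoC (4 * 0 - 3) * besselJ nu (RtoC 1))%C).
      { intros nu. replace (2 * nu + 2 * 0 - 4) with (2 * nu - 4) by ring.
        replace (4 * 0 - 3) with (- (3)) by ring. rewrite RtoC_opp.
        set (A := (RtoC (2 * nu - 4) * besselJ (nu + 1) (RtoC 1))%C).
        split; intros E.
        - replace A with (A + RtoC 3 * besselJ nu (RtoC 1)
            - RtoC 3 * besselJ nu (RtoC 1))%C by ring. rewrite E. ring.
        - rewrite E. ring. }
      destruct (bessel_equation_unique 0 a0 Hal Ha0 H0) as [[H1 H2] H3]. split.
      * split; [exact H1|]. apply Heq, H2.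
      * intros nu [Hnu E]. apply H3. split; [exact Hnu|]. apply Heq, E.
    (* The sign change of [F] locates [a0 = nu_0 + 1] between 0.8561 and 0.8562. *)
    + destruct F_fun_numeric as [Hlo Hhi].
      destruct (F_fun_sign 0 a0 0.8561 Hal ltac:(lra) H0 ltac:(lra)) as [[S1 S2] _].
      destruct (F_fun_sign 0 a0 0.8562 Hal ltac:(lra) H0 ltac:(lra)) as [[S3 S4] _].
      split.
      * destruct (Rlt_or_le 0.8561 a0) as [H|H]; [lra|]. specialize (S2 H). lra.
      * destruct (Req_dec a0 0.8562) as [E|E]; [rewrite E in H0; lra|].
        specialize (S3 (Rlt_le _ _ Hhi)). lra.
    + intros nu Hnu. apply convex_of_order_iff; assumption.
  - intros nu Hnu. replace (5 / 4) with (9 / 4 - 1) by field.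
    apply convex_of_order_iff; try lra.
    (* At [alpha = 3/4] and [a = 9/4] both coefficients [3 - a - alpha] and [3/4 - alpha] vanish. *)
    rewrite F_fun_one by lra. field.
Qed.
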